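(* Let $n\ge 2$, $r\ge 1$, and let $\underline a=(a_1,\dots,a_r)$ be a tuple of integers with $a_i\ge 2$ for all $i$ and $\sum_{i=1}^r (a_i-1)=n-1$. Let $b_i=\sum_{j=1}^i (a_j-1)$. Then $$\sum_{(z_1,\dots,z_r)\in\mathcal{M}(\underline a)} \mathrm{wt}(z_1\cdots z_r)=\prod_{i=1}^{r-1}\big(b_iX_i+n-b_i\big),$$ where $\mathcal{M}(\underline a)$ is the set of minimal factorizations of the long cycle $c=(1,2,\dots,n)$ of type $\underline a$ and $\mathrm{wt}$ is the weight (a monomial in the variables $X_1,\dots,X_{r-1}$) defined in the context.
   Context: $\mathfrak{S}_n$ is the symmetric group on $\{1,\dots,n\}$, with products composed as functions (right to left). $c=(1,2,\dots,n)$ is the long cycle $1\mapsto 2\mapsto\cdots\mapsto n\mapsto 1$. $\mathcal{M}(\underline a)$ is the set of tuples $(z_1,\dots,z_r)$ of elements of $\mathfrak{S}_n$ such that $z_i$ is a cycle of length $a_i$ for each $i$ and $z_1z_2\cdots z_r=c$ (minimality is the condition $\sum_i(a_i-1)=n-1$). A set partition of a finite totally ordered set $T$ is noncrossing if there are no $i<j<k<\ell$ in $T$ with $i,k$ in one block and $j,\ell$ in another block. An interval partition of $T$ is a set partition whose blocks are intervals $[a,b]=\{t\in T: a\le t\le b\}$. A near interval partition of $T$ is a partition obtained from an interval partition of $T$ with at least three blocks by merging its smallest (leftmost) block with its largest (rightmost) block. $\hat 0$ is the partition into singletons and $\hat 1$ the partition with one block. For a noncrossing partition $\pi$ of $\{1,\dots,n\}$,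 $\sigma_\pi\in\mathfrak{S}_n$ is the permutation whose orbits are the blocks of $\pi$ and which satisfies, for each block $\{i_1<\dots<i_s\}$, $\sigma_\pi(i_k)=i_{k+1}$ for $k<s$ and $\sigma_\pi(i_s)=i_1$. $\mathcal{N}(\underline a)$ is the set of $(r+1)$-tuples $(\pi_0,\dots,\pi_r)$ of noncrossing partitions of $\{1,\dots,n\}$ such that $\pi_0=\hat 0$, $\pi_r=\hat 1$, and for each $i$, $\pi_{i-1}$ is obtained from $\pi_i$ by splitting one block $B$ of $\pi_i$ into $a_i$ blocks $B_1,\dots,B_{a_i}$ which form either an interval partition or a near interval partition of $B$ (with the induced order). We write $\pi_{i-1}\sqsubset\pi_i$ when $B_1,\dots,B_{a_i}$ form an interval partition of $B$. The weight of $\Pi=(\pi_0,\dots,\pi_r)\in\mathcal{N}(\underline a)$ is $$\mathrm{wt}(\Pi)=\prod_{\substack{1\le i\le r-1\\ \pi_i\not\sqsubset\pi_{i+1}}}X_i .$$ The map $(\pi_0,\dots,\pi_r)\mapsto(\sigma_{\pi_0}^{-1}\sigma_{\pi_1},\dots,\sigma_{\pi_{r-1}}^{-1}\sigma_{\pi_r})$ is a bijection from $\mathcal{N}(\underline a)$ to $\mathcal{M}(\underline a)$. The weight of $(z_1,\dots,z_r)\in\mathcal{M}(\underline a)$, denoted $\mathrm{wt}(z_1\cdots z_r)$, is $\mathrm{wt}(\Pi)$ for the corresponding $\Pi$; that is, $\pi_i$ is the noncrossing partition with $\sigma_{\pi_i}=z_1\cdots z_i$. *)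

(* Defs.v *)
From HB Require Import structures.
From mathcomp Require Import all_boot all_order all_fingroup all_algebra.
From mathcomp Require Import mpoly.

Set Implicit Arguments.
Unset Strict Implicit.
Unset Printing Implicit Defensive.

Import GRing.Theory.

(* The set {1, ..., n} is modelled by 'I_n, with k standing for k + 1. *)

(* The product of permutations in MathComp is (s * t) x = t (s x); the products
   here are composed right to left: (s \oP t) x = s (t x). *)
Definition permcomp (T : finType) (s t : {perm T}) : {perm T} := (t * s)%g.
Notation "s \oP t" := (permcomp s t) (at level 40, left associativity).

Definition long_cycle (n : nat) : 'S_n := perm (@ordS_inj n).

Definition is_cycle_of_length (n : nat) (z : 'S_n) (m : nat) : bool :=
  [exists x, (#|porbit z x| == m) &&
             [forall y, (y \notin porbit z x) ==> (z y == y)]].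

(* Here and below the entry a_i of a, with 1 <= i <= r, is nth 0 a i.-1. *)
Definition min_factorizations (n r : nat) (a : r.-tuple nat) :
    {set r.-tuple 'S_n} :=
  [set z : r.-tuple 'S_n |
    [forall i : 'I_r, is_cycle_of_length (tnth z i) (nth 0 a i)] &&
    (\big[@permcomp _ / 1%g]_(i < r) tnth z i == long_cycle n)].

Section SetPartitions.
Variable n : nat.
Implicit Types (B : {set 'I_n}) (P Q pi rho : {set {set 'I_n}}).

Definition noncrossing pi : bool :=
  [forall A in pi, forall B in pi, (A != B) ==>
    ~~ [exists i : 'I_n, exists j : 'I_n, exists k : 'I_n, exists l : 'I_n,
         [&& i < j, j < k, k < l, i \in A, k \in A, j \in B & l \in B]]].

Definition interval_in B (A : {set 'I_n}) : bool :=
  [exists a in B, exists b in B, A == [set t in B | a <= t <= b]].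

Definition interval_partition B P : bool :=
  partition P B && [forall A in P, interval_in B A].

Definition left_of (A C : {set 'I_n}) : bool :=
  [forall x in A, forall y in C, x < y].

Definition leftmost Q (L : {set 'I_n}) : bool :=
  (L \in Q) && [forall C in Q, (C != L) ==> left_of L C].

Definition rightmost Q (R : {set 'I_n}) : bool :=
  (R \in Q) && [forall C in Q, (C != R) ==> left_of C R].

Definition near_interval_partition B P : bool :=
  [exists Q : {set {set 'I_n}}, exists L, exists R,
    [&& interval_partition B Q, 3 <= #|Q|, leftmost Q L, rightmost Q R
      & P == (L :|: R) |: (Q :\ L :\ R)]].

(* pi is obtained from rho by splitting one block B of rho into m blocks, which
   form a partition of B of the given kind. *)
Definition splits (kind : {set 'I_n} -> {set {set 'I_n}} -> bool) (m : nat)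
    pi rho : bool :=
  [exists B in rho, exists P : {set {set 'I_n}},
    [&& kind B P, #|P| == m & pi == (rho :\ B) :|: P]].

Definition partition_bot : {set {set 'I_n}} := [set [set x] | x : 'I_n].
Definition partition_top : {set {set 'I_n}} := [set [set: 'I_n]].

End SetPartitions.

Record ncpartition (n : nat) := NCPartition {
  ncval :> {set {set 'I_n}};
  _ : partition ncval [set: 'I_n] && noncrossing ncval }.

HB.instance Definition _ n := [isSub for @ncval n].
HB.instance Definition _ n := [Finite of ncpartition n by <:].

(* Since enum B lists B in increasing order, next (enum B) sends each element
   of B to the following one and the largest to the smallest. *)
Definition nc_succ (n : nat) (pi : ncpartition n) (x : 'I_n) : 'I_n :=
  next (enum (pblock pi x)) x.

Lemma nc_succ_inj (n : nat) (pi : ncpartition n) : injective (nc_succ pi).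
Proof.
case: pi => pi /= pi_nc; have /andP[/and3P[/eqP cov tri _] _] := pi_nc.
have blockE (p := NCPartition pi_nc) x : pblock pi (nc_succ p x) = pblock pi x.
  apply: same_pblock => //; have xb : x \in pblock pi x.
    by rewrite mem_pblock cov inE.
  by rewrite -mem_enum mem_next mem_enum.
move=> x y eq_xy; have eq_b : pblock pi x = pblock pi y.
  by rewrite -blockE eq_xy blockE.
move: eq_xy; rewrite /nc_succ /= eq_b => eq_next.
by apply: (can_inj (prev_next (enum_uniq (pblock pi y)))).
Qed.

Definition nc_perm (n : nat) (pi : ncpartition n) : 'S_n :=
  perm (@nc_succ_inj n pi).

Section Chains.
Variables (n r : nat) (a : r.-tuple nat).
Implicit Type Pi : r.+1.-tuple (ncpartition n).

Definition chain_nth Pi (i : nat) : ncpartition n := tnth Pi (inord i).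

Definition nc_chains : {set r.+1.-tuple (ncpartition n)} :=
  [set Pi | [&& ncval (chain_nth Pi 0) == partition_bot n,
                ncval (chain_nth Pi r) == partition_top n
              & [forall i : 'I_r,
                  splits (@interval_partition n) (nth 0 a i)
                    (chain_nth Pi i) (chain_nth Pi i.+1) ||
                  splits (@near_interval_partition n) (nth 0 a i)
                    (chain_nth Pi i) (chain_nth Pi i.+1)]]].

(* For 0 <= i < r - 1, the generator 'X_i stands for the variable X_(i+1), and
   the condition on i compares the partitions pi_(i+1) and pi_(i+2). *)
Definition chain_weight Pi : {mpoly int[r.-1]} :=
  (\prod_(i < r.-1 | ~~ splits (@interval_partition n) (nth 0%N a i.+1)
                          (chain_nth Pi i.+1) (chain_nth Pi i.+2)) 'X_i)%R.

Definition chain_factorization Pi : r.-tuple 'S_n :=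
  [tuple ((nc_perm (chain_nth Pi i))^-1%g \oP nc_perm (chain_nth Pi i.+1))
    | i < r].

(* When all a_i are at least 2 and the a_i - 1 sum to n - 1, chain_factorization
   is a bijection from nc_chains to min_factorizations n a, so the default
   value 0 is never taken on the latter. *)
Definition factorization_weight (z : r.-tuple 'S_n) : {mpoly int[r.-1]} :=
  if [pick Pi in nc_chains | chain_factorization Pi == z] is Some Pi
  then chain_weight Pi else 0%R.

Definition partial_sum (i : nat) : nat := \sum_(j < i) (nth 0 a j - 1).

End Chains.

(* Main.v *)
(* The weighted sum over the chains below a partition depends only on its block
   sizes: splitting a block of size x into m cyclic arcs amounts to choosing the
   sizes u = (u_1, ..., u_m) of the arcs, the first being the arc of the least
   element, and one of u_1 positions for it; one position gives an interval
   partition and the other u_1 - 1 near interval partitions. So the t-th split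
   has weight 1 + (u_1 - 1) Y_t, where Y_t = X_(t-1).
   Let G_m(t) be the sum, over all compositions s of N into m parts, of the
   weighted sum of the t-step chains ending at block sizes s. Undoing the last
   split merges a_t consecutive parts of a composition of N into
   m' = m + a_t - 1 parts; since rotating a composition does not change the
   weighted sum, u_1 may be replaced by its average N / m', so that
     G_m(t) / m = (m' + (N - m') Y_t) G_m'(t - 1) / m',
   where N - m' = b_(t-1). The theorem is the case m = 1. *)

Require Import Defs.
From mathcomp Require Import all_boot all_order all_fingroup all_algebra.
From mathcomp Require Import mpoly zify ring.
Import GRing.Theory.
Set Implicit Arguments.
Unset Strict Implicit.
Unset Printing Implicit Defensive.
Local Open Scope ring_scope.

(** * Compositions of integers *)

Fixpoint compositions (N m : nat) : seq (seq nat) :=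
  if m is m'.+1 then
    [seq k :: s | k <- iota 1 N, s <- compositions (N - k) m']
  else if N == 0%N then [:: [::]] else [::].

Lemma mem_compositions N m s :
  (s \in compositions N m) = [&& size s == m, sumn s == N & all (leq 1) s].
Proof.
elim: m N s => [|m IH] N s /=.
  by case: N => [|N]; case: s.
apply/allpairsPdep/idP => [[k [u []]]|].
  rewrite mem_iota IH => /andP[k1 kN] /and3P[/eqP <- /eqP su pu] -> /=.
  by rewrite eqxx pu k1 su andbT /=; apply/eqP; lia.
case: s => [|k u] //= /and3P[su /eqP sN /andP[k1 pu]].
exists k, u; rewrite IH mem_iota k1 pu -sN -eqSS su; split=> //; first by lia.
by rewrite addKn eqxx.
Qed.

Lemma compositions_uniq N m : uniq (compositions N m).
Proof.
elim: m N => [|m IH] N /=; first by case: eqP.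
apply: allpairs_uniq_dep => [|k _|]; rewrite ?iota_uniq //.
by move=> [k u] [k' u'] _ _ /= [-> ->].
Qed.

Arguments compositions : simpl never.

(** Rotation is injective and preserves length, sum and positivity of the parts, so it permutes the
    compositions. *)
Lemma big_compositions_rot (V : nmodType) N m j (F : seq nat -> V) :
  \sum_(s <- compositions N m) F (rot j s) = \sum_(s <- compositions N m) F s.
Proof.
rewrite -(big_map (rot j) xpredT F); apply: perm_big.
have rotI : injective (@rot nat j) by apply: rot_inj.
apply: uniq_perm; rewrite ?(map_inj_uniq rotI) ?compositions_uniq // => s.
rewrite -[s in LHS](rotrK j) (mem_map rotI).
rewrite !mem_compositions size_rotr /rotr.
by rewrite (perm_sumn (permEl (perm_rot _ _))) (perm_all _ (permEl (perm_rot _ _))).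
Qed.

(** By rotation, every position contributes as much as the first one. Adding over the [m] positions
    replaces the chosen part by the sum [N] of all parts, so the first part counts as its average
    [N / m]. *)
Lemma sum_compositions_nth (R : pzRingType) N m (F : seq nat -> R) :
    (forall s s', perm_eq s s' -> F s = F s') ->
  (\sum_(s <- compositions N m) F s *+ head 0 s) *+ m =
  (\sum_(s <- compositions N m) F s) *+ N.
Proof.
move=> Fperm; rewrite -[RHS]sumrMnl.
transitivity (\sum_(i < m) \sum_(s <- compositions N m) F s *+ head 0%N s).
  by rewrite sumr_const card_ord.
under eq_bigr => i _ do rewrite -(big_compositions_rot _ _ i).
rewrite exchange_big big_seq [RHS]big_seq; apply: eq_bigr => s.
rewrite mem_compositions => /and3P[/eqP sm /eqP <- _].
rewrite (eq_bigr (fun i : 'I_m => F s *+ nth 0%N s i)) => [|i _].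
  by rewrite -sm sumrMnr sumnE (big_nth 0%N) big_mkord.
rewrite (Fperm _ _ (permEl (perm_rot _ _))); congr (_ *+ _).
by rewrite -nth0 nth_cat size_drop subn_gt0 sm ltn_ord nth_drop addn0.
Qed.

(** Rotation by [i] brings the [i]-th part to the head. What follows it is [rem x s] up to order,
    even when the value [x] is repeated. *)
Lemma sum_compositions_rem (V : nmodType) N m (F : nat -> seq nat -> V) :
    (forall x s s', perm_eq s s' -> F x s = F x s') ->
  \sum_(s <- compositions N m) \sum_(x <- s) F x (rem x s) =
  (\sum_(s <- compositions N m) F (head 0%N s) (behead s)) *+ m.
Proof.
move=> Fperm; transitivity (\sum_(i < m)
    \sum_(s <- compositions N m) F (head 0%N s) (behead s)); last first.
  by rewrite sumr_const card_ord.
under [RHS]eq_bigr => i _ do rewrite -(big_compositions_rot _ _ i).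
rewrite exchange_big big_seq [RHS]big_seq; apply: eq_bigr => s.
rewrite mem_compositions => /and3P[/eqP sm _ _].
rewrite (big_nth 0%N) big_mkord sm; apply: eq_bigr => i _.
have lt_is : (i < size s)%N by rewrite sm.
have rotE : rot i s = nth 0%N s i :: behead (rot i s).
  by rewrite /rot (drop_nth 0%N).
rewrite [in head _ _]rotE; apply: Fperm; rewrite -(perm_cons (nth 0%N s i)) -rotE.
rewrite -(permPl (perm_to_rem (mem_nth 0%N lt_is))).
by rewrite perm_sym (permPl (permEl (perm_rot _ _))).
Qed.

(** Refining the first part into [k] parts is undone by adding up the first [k] parts of the result;
    [0 < k] makes this sum positive. *)
Lemma sum_compositions_cat (V : nmodType) N m k (F : seq nat -> V) :
    (0 < k)%N ->
  \sum_(s <- compositions N m.+1) \sum_(u <- compositions (head 0%N s) k)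
     F (u ++ behead s) =
  \sum_(v <- compositions N (k + m)) F v.
Proof.
move=> k0.
transitivity (\sum_(v <- [seq u ++ behead s | s <- compositions N m.+1,
                                    u <- compositions (head 0%N s) k]) F v).
  by rewrite [RHS]big_allpairs_dep.
apply/perm_big/uniq_perm; rewrite ?compositions_uniq //.
  apply: allpairs_uniq_dep => [|s _|]; rewrite ?compositions_uniq //.
  move=> _ _ /allpairsPdep[s [u [s1 u1 ->]]] /allpairsPdep[s' [u' [s1' u1' ->]]] /=.
  move: s1 u1 s1' u1'; rewrite !mem_compositions.
  case: s s' => [|x s] [|x' s'] //= /and3P[/eqP[szs] /eqP sN _].
  move=> /and3P[/eqP uk /eqP ux _] /and3P[_ _ _] /and3P[/eqP uk' /eqP ux' _].
  move/eqP; rewrite eqseq_cat ?uk // => /andP[/eqP eu /eqP ->].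
  by rewrite -ux -ux' eu.
move=> v; rewrite mem_compositions; apply/allpairsPdep/idP.
  move=> [[|x s] [u []]]; rewrite !mem_compositions //=.
  move=> /and3P[/eqP[<-] /eqP <- /andP[_ ps]] /and3P[/eqP <- /eqP <- pu] ->.
  by rewrite size_cat sumn_cat all_cat ps pu !eqxx.
move=> /and3P[/eqP vk /eqP vN pv].
have /andP[pt pd] : all (leq 1) (take k v) && all (leq 1) (drop k v).
  by rewrite -all_cat cat_take_drop.
have szt : size (take k v) = k by rewrite size_take vk; case: ltnP => //; lia.
exists (sumn (take k v) :: drop k v), (take k v); rewrite !mem_compositions /=.
rewrite szt !eqxx pt cat_take_drop -sumn_cat cat_take_drop vN eqxx /=; split=> //.
rewrite size_drop vk addKn eqxx /=.
rewrite pd andbT.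
case: (take k v) szt pt => [|x t] /=; first by lia.
by move=> _ /andP[]; lia.
Qed.

(** * Weighted count of chains by block sizes *)

Section ChainGF.
Variables (R : comPzRingType) (Y : nat -> R) (a : nat -> nat).

(* Total weight of the t-step chains from the discrete partition to a partition
   with block sizes s. A block of size x is split into arcs, of sizes u in
   cyclic order from the arc of its least element on; (head 0 u).-1 is the
   number of positions of the arcs for which the first one wraps around. *)
Fixpoint chain_gf (t : nat) (s : seq nat) : R :=
  if t is t'.+1 then
    \sum_(x <- s) \sum_(u <- compositions x (a t'))
       (1 + Y t' *+ (head 0%N u).-1) * chain_gf t' (u ++ rem x s)
  else (all (pred1 1%N) s)%:R.

Lemma perm_chain_gf t s s' : perm_eq s s' -> chain_gf t s = chain_gf t s'.
Proof.
elim: t s s' => [|t IH] s s' ss' /=; first by rewrite (perm_all _ ss').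
rewrite (perm_big _ ss') big_seq [RHS]big_seq; apply: eq_bigr => x xs'.
apply: eq_bigr => u _; congr (_ * _); apply: IH.
rewrite perm_cat2l -(perm_cons x) -(permPr (perm_to_rem xs')).
by rewrite perm_sym -(permPr (perm_to_rem _)) 1?perm_sym // (perm_mem ss').
Qed.

(** Division-free form of the recursion for G_m(t): cancelling a positive integer replaces the
    division by m'. For [0 < t] the factor [i = 0] has an empty sum and equals [N], which balances
    the multiplier [N] on the left. *)
Lemma sum_chain_gf t m N :
    (forall n : nat, (0 < n)%N -> injective (fun x : R => x *+ n)) ->
    (forall i, (i < t)%N -> (0 < a i)%N) ->
    N = (m + \sum_(i < t) (a i - 1))%N ->
  (\sum_(s <- compositions N m) chain_gf t s) *+ N =
  (\prod_(i < t) (Y i *+ \sum_(j < i) (a j - 1)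
                  + (N - \sum_(j < i) (a j - 1))%:R)) *+ m.
Proof.
move=> mulIn; elim: t m => [|t IH] m a_gt0 defN.
  rewrite big_ord0 addn0 in defN; rewrite defN big_ord0; congr (_ *+ _).
  have comps : perm_eq (compositions m m) [:: nseq m 1%N].
    apply: uniq_perm; rewrite ?compositions_uniq // => s.
    rewrite mem_compositions inE; apply/and3P/eqP => [[]|->]; last first.
      by rewrite size_nseq sumn_nseq mul1n all_nseq !eqxx orbT.
    have le_size s' : all (leq 1) s' -> (size s' <= sumn s')%N.
      by elim: s' => //= x s' IH /andP[x_gt0 /IH]; lia.
    elim: s m {defN} => [|x s IH] [|m] //= /eqP[sm] /eqP sN /andP[x_gt0 s_gt0].
    have := le_size s s_gt0 => le_s.
    have x1 : x = 1%N by lia.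
    by move: sN; rewrite x1 => -[sN]; rewrite (IH m) ?sm // -sN.
  by rewrite (perm_big _ comps) big_seq1 /= all_nseq orbT.
case: m defN => [|m] defN.
  rewrite mulr0n; case: (posnP N) => [->|N_gt0]; first by rewrite mulr0n.
  by rewrite /compositions gtn_eqF // big_nil mul0rn.
have at_gt0 : (0 < a t)%N by apply: a_gt0.
rewrite big_ord_recr /= in defN.
set b := (\sum_(j < t) (a j - 1))%N in defN IH.
(* From here on the number of parts is [m.+1]. Undoing the last split turns one part into [a t]
   parts, so the induction hypothesis is taken at [a t + m]. *)
have {}IH := IH (a t + m)%N (fun i lt_it => a_gt0 i (ltnW lt_it)).
have {}IH := IH ltac:(lia).
rewrite big_ord_recr /= -/b; set P := \prod_(i < t) _ in IH *.
have -> : (N - b)%N = (a t + m)%N by lia.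
rewrite /= (@sum_compositions_rem _ _ _ (fun x s => \sum_(u <- compositions x (a t))
       (1 + Y t *+ (head 0%N u).-1) * chain_gf t (u ++ s))); last first.
  move=> x s s' ss'; apply: eq_bigr => u _; congr (_ * _).
  by apply: perm_chain_gf; rewrite perm_cat2l.
pose F v := (1 + Y t *+ (head 0%N v).-1) * chain_gf t v.
have -> : \sum_(s <- compositions N m.+1)
    \sum_(u <- compositions (head 0%N s) (a t))
       (1 + Y t *+ (head 0%N u).-1) * chain_gf t (u ++ behead s) =
    \sum_(v <- compositions N (a t + m)) F v.
  rewrite -sum_compositions_cat //; apply: eq_bigr => s _.
  rewrite big_seq [RHS]big_seq; apply: eq_bigr => u.
  rewrite mem_compositions /F => /and3P[/eqP ua _ _].
  by case: u ua => [|//] /= ua; rewrite -ua in at_gt0.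
have defF : \sum_(v <- compositions N (a t + m)) F v =
    \sum_(v <- compositions N (a t + m)) chain_gf t v +
    Y t * \sum_(v <- compositions N (a t + m)) chain_gf t v *+ (head 0%N v).-1.
  rewrite mulr_sumr -big_split; apply: eq_bigr => v _.
  by rewrite /F mulrDl mul1r mulrnAl mulrnAr.
have := sum_compositions_nth N (a t + m) (perm_chain_gf t).
have -> : \sum_(v <- compositions N (a t + m)) chain_gf t v *+ head 0%N v =
    \sum_(v <- compositions N (a t + m)) chain_gf t v *+ (head 0%N v).-1 +
    \sum_(v <- compositions N (a t + m)) chain_gf t v.
  rewrite -big_split big_seq [RHS]big_seq; apply: eq_bigr => v.
  rewrite mem_compositions => /and3P[/eqP va _].
  case: v va => [|k v] /= va; first by lia.
  by case/andP; case: k => // k _ _; rewrite -mulrSr.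
rewrite {}defF; set H := \sum_(v <- _) _ *+ _; set G := \sum_(v <- _) _ in IH *.
move=> eqH; apply: (mulIn (a t + m)%N); first by lia.
(* With m' = [a t + m], the averaging identity reads (H + G) m' = G N; since N = b + m', this leaves
   H m' = G b. *)
have defH : H *+ (a t + m) = G *+ b.
  apply: (@addIr _ (G *+ (a t + m))); rewrite -mulrnDl eqH -mulrnDr.
  by congr (_ *+ _); lia.
transitivity ((G *+ N *+ (a t + m) + Y t * (H *+ (a t + m)) *+ N) *+ m.+1).
  by ring.
rewrite defH; transitivity ((G *+ N) * (Y t *+ b + (a t + m)%:R) *+ m.+1).
  by ring.
by rewrite IH; ring.
Qed.

End ChainGF.

(** * Set partitions and lists of lists *)

Section SetBlocks.
Variable T : finType.
Implicit Types (ss : seq (seq T)) (l : seq T).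

(** Lists of lists record an order of the blocks and an order inside each block, which the set
    partition forgets. The enumeration is carried out on lists. *)
Definition set_blocks ss : {set {set T}} := [set:: [seq [set:: l] | l <- ss]].

Lemma set_blocksP ss A :
  reflect (exists2 l, l \in ss & A = [set:: l]) (A \in set_blocks ss).
Proof. by rewrite inE; apply: mapP. Qed.

Lemma set_blocks_cons l ss : set_blocks (l :: ss) = [set:: l] |: set_blocks ss.
Proof. exact: set_cons. Qed.

Lemma eq_set_blocks ss ss' : ss =i ss' -> set_blocks ss = set_blocks ss'.
Proof. by move=> e; apply/setP=> A; rewrite !inE; apply: eq_mem_map. Qed.

Lemma uniq_flatten_mem ss l l' x : uniq (flatten ss) ->
  l \in ss -> l' \in ss -> x \in l -> x \in l' -> l = l'.
Proof.
elim: ss => //= k ss IH; rewrite cat_uniq => /and3P[_ /hasPn kss uss].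
rewrite !inE => /orP[/eqP->|lss] /orP[/eqP->|l'ss] // xl xl'; last exact: IH.
  have /kss/= : x \in flatten ss by apply/flattenP; exists l'.
  by rewrite xl.
have /kss/= : x \in flatten ss by apply/flattenP; exists l.
by rewrite xl'.
Qed.

Lemma uniq_flatten_sub ss l : uniq (flatten ss) -> l \in ss -> uniq l.
Proof.
elim: ss => //= k ss IH; rewrite cat_uniq => /and3P[uk _ uss].
by rewrite inE => /orP[/eqP->|/IH ->].
Qed.

Lemma uniq_flatten_nil ss : uniq (flatten ss) -> [::] \notin ss -> uniq ss.
Proof.
elim: ss => //= l ss IH; rewrite cat_uniq inE negb_or eq_sym.
move=> /and3P[_ /hasPn lss uss] /andP[l0 ss0]; rewrite IH // andbT.
case: l l0 lss => // x l _ lss; apply/negP => xl_ss.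
have /lss/= : x \in flatten ss by apply/flattenP; exists (x :: l); rewrite ?mem_head.
by rewrite mem_head.
Qed.

Variable ss : seq (seq T).
Hypotheses (ss_uniq : uniq (flatten ss)) (ss0 : [::] \notin ss).

Lemma set_blocks_uniq : uniq [seq [set:: l] | l <- ss].
Proof.
rewrite map_inj_in_uniq ?uniq_flatten_nil // => -[|x l] l'.
  by move=> nss; case/negP: ss0.
move=> lss l'ss /setP/(_ x); rewrite !inE eqxx /= => /esym xl'.
by apply: uniq_flatten_mem lss l'ss (mem_head x l) xl'.
Qed.

Lemma card_set_blocks : #|set_blocks ss| = size ss.
Proof. by rewrite cardsE (card_uniqP set_blocks_uniq) size_map. Qed.

Lemma perm_card_set_blocks :
  perm_eq [seq #|(A : {set T})| | A <- enum (set_blocks ss)] (shape ss).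
Proof.
have /(perm_map (fun A : {set T} => #|A|)) :
    perm_eq (enum (set_blocks ss)) [seq [set:: l] | l <- ss].
  by apply: uniq_perm; rewrite ?enum_uniq ?set_blocks_uniq // => A; rewrite mem_enum inE.
rewrite -map_comp => /permPl->.
rewrite [X in perm_eq X](_ : _ = shape ss) //; apply/eq_in_map => l lss /=.
by rewrite cardsE; apply/card_uniqP/(uniq_flatten_sub ss_uniq).
Qed.

Lemma partition_set_blocks : partition (set_blocks ss) [set:: flatten ss].
Proof.
apply/and3P; split.
- apply/eqP/setP=> x; rewrite inE; apply/bigcupP/flattenP.
    by case=> _ /set_blocksP[l lss ->]; rewrite inE; exists l.
  by case=> l lss xl; exists [set:: l]; rewrite ?inE //; apply: map_f.
- apply/trivIsetP => _ _ /set_blocksP[l lss ->] /set_blocksP[l' lss' ->].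
  apply: contraNT => /pred0Pn[x /andP[/=]]; rewrite !inE => xl xl'.
  by rewrite (uniq_flatten_mem ss_uniq lss lss' xl xl').
- apply/set_blocksP => -[[|x l] lss /setP]; first by case/negP: ss0.
  by move=> /(_ x); rewrite !inE eqxx.
Qed.

Lemma pblock_set_blocks l x : l \in ss -> x \in l ->
  pblock (set_blocks ss) x = [set:: l].
Proof.
move=> lss xl; have /and3P[_ tss _] := partition_set_blocks.
by apply: def_pblock => //; rewrite ?inE //; apply: map_f.
Qed.

End SetBlocks.

(** The block of the first element of the common flattening has the same cardinality on both sides,
    so the two first lists have equal length and agree. This block is then removed from both. *)
Lemma set_blocks_inj (T : finType) (ss ss' : seq (seq T)) :
    uniq (flatten ss) -> [::] \notin ss -> [::] \notin ss' ->
    flatten ss = flatten ss' -> set_blocks ss = set_blocks ss' -> ss = ss'.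
Proof.
elim: ss ss' => [|l ss IH] [|l' ss'] //.
- by rewrite inE; case: l'.
- by move=> _; rewrite inE; case: l.
move=> u n n' e eb; have u' : uniq (flatten (l' :: ss')) by rewrite -e.
have el : l = l'.
  case: l l' u u' n n' e eb => [|x l] // [|x' l'] // u u' n n' e eb.
  move: (e) => /= [ex ell]; rewrite -ex in u' n' e eb *.
  have : pblock (set_blocks ((x :: l) :: ss)) x = [set:: x :: l].
    by apply: pblock_set_blocks; rewrite // mem_head.
  rewrite eb (@pblock_set_blocks _ _ u' n' (x :: l')) ?mem_head //.
  move=> /(congr1 (fun A : {set T} => #|A|)); rewrite !cardsE.
  rewrite (card_uniqP (uniq_flatten_sub u (mem_head _ _))).
  rewrite (card_uniqP (uniq_flatten_sub u' (mem_head _ _))).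
  move=> /eqP; rewrite eqSS => /eqP sz; congr (_ :: _).
  by move/eqP: ell; rewrite eqseq_cat // => /andP[/eqP].
rewrite -el in n' u' e eb *; congr (_ :: _).
move: e => /= /eqP; rewrite eqseq_cat // eqxx => /eqP e.
have hu := set_blocks_uniq u n; have hu' := set_blocks_uniq u' n'.
move: u n n'; rewrite /= cat_uniq !inE !negb_or.
move=> /and3P[_ _ u] /andP[_ n] /andP[_ n']; apply: IH => //.
rewrite !set_blocks_cons in eb; apply/setP => A.
move/setP/(_ A): eb; move: hu hu'; rewrite /= !inE => /andP[lss _] /andP[lss' _].
by case: eqP => [->|_ //]; rewrite (negPf lss) (negPf lss').
Qed.

(** * Interval partitions as cuts of a sorted list *)

Section Intervals.
Local Open Scope nat_scope.
Variable n : nat.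
Implicit Types (A B C L : {set 'I_n}) (P Q : {set {set 'I_n}}).
Implicit Types (l r : seq 'I_n) (ss mid : seq (seq 'I_n)).

Definition ord_lt (i j : 'I_n) : bool := i < j.

Lemma ord_lt_trans : transitive ord_lt.
Proof. by move=> j i k; apply: ltn_trans. Qed.

Lemma pairwise_enum B : pairwise ord_lt (enum B).
Proof.
rewrite -(sorted_pairwise ord_lt_trans) {1}/enum_mem -enumT.
apply: (sorted_filter ord_lt_trans).
by rewrite -(sorted_map (f := val) (e' := ltn)) val_enum_ord iota_ltn_sorted.
Qed.

Lemma enum_pairwise l : pairwise ord_lt l -> enum [set:: l] = l.
Proof.
move=> sl; apply: (irr_sorted_eq ord_lt_trans) => [i||| x].
- exact: ltnn.
- by rewrite sorted_pairwise ?pairwise_enum //; apply: ord_lt_trans.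
- by rewrite sorted_pairwise //; apply: ord_lt_trans.
- by rewrite mem_enum inE.
Qed.

Lemma set_enum B : [set:: enum B] = B.
Proof. by apply/setP => x; rewrite inE mem_enum. Qed.

Lemma left_of_enum A C : left_of A C -> enum (A :|: C) = enum A ++ enum C.
Proof.
move=> /'forall_implyP AC; rewrite -[LHS]enum_pairwise ?pairwise_enum //.
rewrite -[RHS]enum_pairwise.
  by apply: eq_enum => x; rewrite !inE mem_enum mem_cat !mem_enum inE.
rewrite pairwise_cat !pairwise_enum !andbT; apply/allrelP => x y.
by rewrite !mem_enum => /AC/'forall_implyP; apply.
Qed.

(** Elements of earlier pieces lie below the first element of a piece and those of later pieces
    above its last one, so each piece is the interval of [B] between its two ends. *)
Lemma interval_partition_blocks B ss :
    flatten ss = enum B -> [::] \notin ss -> interval_partition B (set_blocks ss).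
Proof.
move=> ssB ss0; have uss : uniq (flatten ss) by rewrite ssB enum_uniq.
apply/andP; split; first by rewrite -(set_enum B) -ssB partition_set_blocks.
apply/'forall_implyP => _ /set_blocksP[l lss ->].
have BE x : (x \in B) = (x \in flatten ss) by rewrite ssB mem_enum.
have := pairwise_enum B; rewrite -ssB.
case: l lss => [nss|a l lss]; first by case/negP: ss0.
have lB x : x \in a :: l -> x \in B by rewrite BE => xl; apply/flattenP; exists (a :: l).
move=> pw; apply/'exists_andP; exists a; split; first exact/lB/mem_head.
apply/'exists_andP; exists (last a l); split; first exact/lB/mem_last.
apply/eqP/setP => t; rewrite !inE -in_cons BE.
case/splitPr: lss pw => s1 s2; rewrite flatten_cat /= !pairwise_cat -cat_cons.
rewrite pairwise_cat => /and3P[/allrelP s1l _ /and3P[/allrelP ls2 pl _]].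
rewrite !mem_cat; case tl: (t \in a :: l).
  rewrite orbT /=; move: pl tl => /=.
  move=> /andP[/allP al pl] tl; apply/esym/andP; split.
    by move: tl; rewrite inE => /orP[/eqP->//|/al/ltnW].
  have : pairwise ord_lt (a :: l) by rewrite /= pl andbT; apply/allP.
  rewrite lastI pairwise_rcons => /andP[/allP bl _].
  by move: tl; rewrite lastI mem_rcons inE => /orP[/eqP->//|/bl/ltnW].
case ts1: (t \in flatten s1).
  apply/esym; rewrite /= leqNgt.
  have al : a \in (a :: l) ++ flatten s2 by rewrite mem_cat mem_head.
  by have := s1l t a ts1 al; rewrite /ord_lt => ->.
case ts2: (t \in flatten s2) => //=.
apply/esym; rewrite [t <= _]leqNgt.
by have := ls2 (last a l) t (mem_last _ _) ts2; rewrite /ord_lt => ->; rewrite andbF.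
Qed.

(** Induction on the number of blocks: the block of the least element of [B] is an initial segment,
    so [enum B] starts with it, and the other blocks form an interval partition of the rest. *)
Lemma interval_partition_ex B P : interval_partition B P ->
  exists ss, [/\ flatten ss = enum B, [::] \notin ss & P = set_blocks ss].
Proof.
elim: {P}#|P| {-2}P (erefl #|P|) B => [|m IH] P cardP B /andP[partP /'forall_implyP intP].
  move/eqP: cardP; rewrite cards_eq0 => /eqP P0; exists [::].
  move: partP; rewrite P0 => /and3P[/eqP <- _ _].
  by rewrite /cover big_set0 enum_set0; split=> //; apply/setP => A; rewrite !inE.
have /and3P[/eqP covP triP P0] := partP.
case defB: (enum B) => [|x s].
  suff : P = set0 by move=> P_0; rewrite P_0 cards0 in cardP.
  apply/eqP; rewrite -(partition_set0 P).
  suff <- : B = set0 by [].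
  by apply/setP => x; rewrite -mem_enum defB !inE.
have xB : x \in B by rewrite -mem_enum defB mem_head.
have minx y : y \in B -> x <= y.
  have := pairwise_enum B; rewrite -mem_enum defB /= => /andP[/allP xs _].
  by rewrite inE => /orP[/eqP->//|/xs/ltnW].
pose A := pblock P x; have AP : A \in P by rewrite pblock_mem ?covP.
have xA : x \in A by rewrite mem_pblock covP.
have sub C : C \in P -> C \subset B by move=> CP; rewrite -covP; apply: bigcup_sup.
have /'exists_andP[a [aB /'exists_andP[b [bB /eqP defA]]]] := intP A AP.
(* The interval [A] contains the least element of [B], so its lower bound [a] imposes nothing. *)
have Ale y : y \in A = (y \in B) && (y <= b).
  move: (xA); rewrite defA !inE => /and3P[_ ax _].
  by case yB: (y \in B) => //=; rewrite (leq_trans ax) ?minx.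
have leftA : left_of A (B :\: A).
  apply/'forall_implyP => y yA; apply/'forall_implyP => z; rewrite inE !Ale.
  case zB: (z \in B); rewrite ?andbF //= andbT -ltnNge.
  by move: yA; rewrite Ale => /andP[_ yb]; apply: leq_ltn_trans.
have [||ss [ssB ss0 Pss]] := IH (P :\ A) _ (B :\: A).
- by move: cardP; rewrite (cardsD1 A) AP => -[].
- apply/andP; split; first exact: partitionD1.
  apply/'forall_implyP => C /setD1P[CA CP].
  have /'exists_andP[c [cB /'exists_andP[d [dB /eqP defC]]]] := intP C CP.
  have dCA : [disjoint C & A] by apply: (trivIsetP triP).
  have [z zC] : exists z, z \in C by apply/set0Pn; apply: partition_neq0 partP CP.
  have cd : c <= d by move: zC; rewrite defC inE => /and3P[_]; apply: leq_trans.
  have CB y : y \in C -> y \in B :\: A.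
    by move=> yC; rewrite inE (disjointFr dCA yC) (subsetP (sub C CP)).
  apply/'exists_andP; exists c; split; first by apply: CB; rewrite defC inE cB leqnn.
  apply/'exists_andP; exists d; split; first by apply: CB; rewrite defC inE dB cd leqnn.
  apply/eqP/setP => y; apply/idP/idP => [yC|].
    by rewrite inE CB //; move: yC; rewrite defC inE => /andP[].
  by rewrite !inE defC inE => /andP[/andP[_ ->]].
have enumB : enum B = enum A ++ enum (B :\: A).
  rewrite -left_of_enum //; apply: eq_enum => y; rewrite !inE.
  by case yA: (y \in A) => //=; apply: (subsetP (sub A AP)).
exists (enum A :: ss); rewrite /= ssB -enumB inE negb_or ss0 andbT; split=> //.
  by apply: contraTneq xA => A0; rewrite -mem_enum -A0.
by rewrite set_blocks_cons set_enum -Pss setD1K.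
Qed.

End Intervals.

(** * Near interval partitions as cuts of a rotated list *)

Section NearIntervals.
Local Open Scope nat_scope.
Variable n : nat.
Implicit Types (A B C L : {set 'I_n}) (P Q : {set {set 'I_n}}).
Implicit Types (l r : seq 'I_n) (ss mid : seq (seq 'I_n)).

Lemma left_of_neq Q B A C : partition Q B -> A \in Q -> C \in Q ->
  left_of A C -> ~~ left_of C A.
Proof.
move=> partQ AQ CQ /'forall_implyP AC; apply/'forall_implyP => CA.
have [x xA] := set0Pn _ (partition_neq0 partQ AQ).
have [y yC] := set0Pn _ (partition_neq0 partQ CQ).
have /'forall_implyP/(_ y yC) := AC x xA.
by have /'forall_implyP/(_ x xA) := CA y yC; lia.
Qed.

Lemma leftmost_uniq Q B L L' : partition Q B ->
  leftmost Q L -> leftmost Q L' -> L = L'.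
Proof.
move=> pQ /andP[LQ /'forall_implyP h] /andP[LQ' /'forall_implyP h'].
apply/eqP; apply: contraT => LL'; have := left_of_neq pQ LQ LQ'.
by rewrite (implyP (h _ LQ')) 1?eq_sym // (implyP (h' _ LQ)) //; apply.
Qed.

Lemma rightmost_uniq Q B L L' : partition Q B ->
  rightmost Q L -> rightmost Q L' -> L = L'.
Proof.
move=> pQ /andP[LQ /'forall_implyP h] /andP[LQ' /'forall_implyP h'].
apply/eqP; apply: contraT => LL'; have := left_of_neq pQ LQ LQ'.
by rewrite (implyP (h' _ LQ)) // (implyP (h _ LQ')) 1?eq_sym //; apply.
Qed.

Lemma leftmost_blocks B l ss : flatten (l :: ss) = enum B ->
  leftmost (set_blocks (l :: ss)) [set:: l].
Proof.
move=> eB; rewrite /leftmost set_blocks_cons setU11 /=.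
apply/'forall_implyP => C; rewrite in_setU1 => /predU1P[->|]; first by rewrite eqxx.
case/set_blocksP => l' l'ss ->; apply/implyP => _.
apply/'forall_implyP => x; rewrite inE => xl; apply/'forall_implyP => y.
rewrite inE => yl'; have := pairwise_enum B; rewrite -eB /= pairwise_cat.
by case/andP => /allrelP h _; apply: h => //; apply/flattenP; exists l'.
Qed.

Lemma rightmost_blocks B r ss : flatten (rcons ss r) = enum B ->
  rightmost (set_blocks (rcons ss r)) [set:: r].
Proof.
move=> eB; rewrite /rightmost (eq_set_blocks (mem_rcons ss r)).
rewrite set_blocks_cons setU11 /=.
apply/'forall_implyP => C; rewrite in_setU1 => /predU1P[->|]; first by rewrite eqxx.
case/set_blocksP => l' l'ss ->; apply/implyP => _.
apply/'forall_implyP => x; rewrite inE => xl; apply/'forall_implyP => y.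
rewrite inE => yl'; have := pairwise_enum B; rewrite -eB flatten_rcons pairwise_cat.
by case/andP => /allrelP h _; apply: h => //; apply/flattenP; exists l'.
Qed.

(** The merged block is listed as [r ++ l] because the last block is followed cyclically by the
    first one: the lists then cut a rotation of the sorted list. *)
Lemma set_blocks_merge l mid r :
    uniq (flatten (l :: rcons mid r)) -> [::] \notin l :: rcons mid r ->
  set_blocks ((r ++ l) :: mid) =
  ([set:: l] :|: [set:: r])
    |: (set_blocks (l :: rcons mid r) :\ [set:: l] :\ [set:: r]).
Proof.
move=> u n0; have := set_blocks_uniq u n0; rewrite /= map_rcons mem_rcons rcons_uniq.
rewrite in_cons negb_or => /and3P[/andP[lr lm] rm _].
rewrite set_blocks_cons; congr (_ |: _).
  by apply/setP => x; rewrite !inE mem_cat orbC.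
apply/setP => A; rewrite !in_setD1 set_blocks_cons.
rewrite (eq_set_blocks (mem_rcons mid r)) set_blocks_cons !in_setU1 in_set.
case: eqP => [->|_] /=; first by rewrite (negPf rm).
by case: eqP => [->|_] //=; rewrite (negPf lm).
Qed.

Lemma near_interval_partition_blocks B l mid r :
    flatten (l :: rcons mid r) = enum B -> [::] \notin l :: rcons mid r ->
    mid != [::] ->
  near_interval_partition B (set_blocks ((r ++ l) :: mid)).
Proof.
move=> eB n0 mid0; have u : uniq (flatten (l :: rcons mid r)) by rewrite eB enum_uniq.
apply/existsP; exists (set_blocks (l :: rcons mid r)).
apply/existsP; exists [set:: l]; apply/existsP; exists [set:: r].
rewrite interval_partition_blocks // (leftmost_blocks eB).
rewrite -rcons_cons in eB *; rewrite (rightmost_blocks eB) rcons_cons.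
rewrite set_blocks_merge // eqxx card_set_blocks //= size_rcons andbT.
by case: mid mid0 {eB n0 u}.
Qed.

Lemma near_interval_partition_ex B P : near_interval_partition B P ->
  exists l mid r, [/\ flatten (l :: rcons mid r) = enum B,
    [::] \notin l :: rcons mid r, mid != [::] & P = set_blocks ((r ++ l) :: mid)].
Proof.
case/existsP=> Q /existsP[L /existsP[R /and5P[iQ cQ lQ rQ /eqP->]]].
have /andP[pQ _] := iQ; have [ss [eB ss0 defQ]] := interval_partition_ex iQ.
have u : uniq (flatten ss) by rewrite eB enum_uniq.
move: cQ; rewrite defQ card_set_blocks //.
case: ss eB ss0 defQ u => [|l ss] //; case/lastP: ss => [|mid r] // eB ss0 defQ u.
rewrite /= size_rcons => szm; exists l, mid, r; split=> //.
  by case: mid szm {eB ss0 defQ u}.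
rewrite set_blocks_merge //.
have -> : L = [set:: l].
  by apply: leftmost_uniq pQ lQ _; rewrite defQ (leftmost_blocks eB).
have -> // : R = [set:: r].
apply: rightmost_uniq pQ rQ _; rewrite defQ -rcons_cons.
by apply: (@rightmost_blocks B); rewrite rcons_cons.
Qed.

End NearIntervals.

(** * Uniqueness of the cut behind a near interval partition *)

Section MergedBlocks.
Local Open Scope nat_scope.
Variable T : finType.
Implicit Types (l r p q : seq T) (mid ss : seq (seq T)).

Lemma uniq_merge p q ss :
  uniq (flatten (p :: rcons ss q)) -> uniq (flatten ((q ++ p) :: ss)).
Proof. by rewrite /= flatten_rcons catA uniq_catC catA. Qed.

Lemma nil_merge p q ss : [::] \notin p :: rcons ss q -> [::] \notin (q ++ p) :: ss.
Proof.
rewrite !inE mem_rcons inE !negb_or => /and3P[p0 _ ->]; rewrite andbT.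
by case: q => //; case: p p0.
Qed.

(** Both merged blocks contain the first element of the common flattening, hence they are the same
    block. *)
Lemma merged_blocks_head l r mid l' r' mid' :
    uniq (flatten (l :: rcons mid r)) ->
    [::] \notin l :: rcons mid r -> [::] \notin l' :: rcons mid' r' ->
    flatten (l :: rcons mid r) = flatten (l' :: rcons mid' r') ->
    set_blocks ((r ++ l) :: mid) = set_blocks ((r' ++ l') :: mid') ->
  r ++ l =i r' ++ l'.
Proof.
move=> u n0 n0' e eb x.
have u' : uniq (flatten (l' :: rcons mid' r')) by rewrite -e.
have p1 := pblock_set_blocks (uniq_merge u) (nil_merge n0) (mem_head _ _).
have p2 := pblock_set_blocks (uniq_merge u') (nil_merge n0') (mem_head _ _).
case: l l' n0 n0' u u' e eb p1 p2 => [|y l] [|y' l'] // n0 n0' u u' e eb p1 p2.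
have yl : y \in r ++ y :: l by rewrite mem_cat mem_head orbT.
have yl' : y \in r' ++ y' :: l'.
  by move: e => /= -[<- _]; rewrite mem_cat mem_head orbT.
by move: (p1 y yl); rewrite eb p2 // => /setP/(_ x); rewrite !inE.
Qed.

(** If [l] were longer than [l'], the first element of [mid'] would lie in [l], hence in the merged
    block, which is disjoint from the blocks of [mid']. *)
Lemma merged_blocks_leq l r mid l' r' mid' :
    uniq (flatten (l :: rcons mid r)) ->
    [::] \notin l :: rcons mid r -> [::] \notin l' :: rcons mid' r' ->
    mid' != [::] ->
    flatten (l :: rcons mid r) = flatten (l' :: rcons mid' r') ->
    set_blocks ((r ++ l) :: mid) = set_blocks ((r' ++ l') :: mid') ->
  size l <= size l'.
Proof.
move=> u n0 n0' mid0' e eb; rewrite leqNgt; apply/negP => lt_l.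
have eA := merged_blocks_head u n0 n0' e eb; rewrite e in u.
move: (uniq_merge u) mid0' n0' e => {eb u}.
case: mid' => [|m mid'] // u _; rewrite !inE !negb_or => /and3P[_ m0 _].
case: m m0 u => // z m _ u /= /(congr1 (take (size l))).
rewrite take_size_cat // take_cat ltnNge ltnW //= => el.
move: u => /=; rewrite cat_uniq => /and3P[_ /hasPn/(_ z)].
rewrite mem_head => /(_ isT)/= /negP[].
rewrite -eA mem_cat el mem_cat.
by move: lt_l; rewrite -subn_gt0; case: (_ - _) => //= k _; rewrite mem_head !orbT.
Qed.

(** [merged_blocks_leq] in both directions gives the length of [l], and the size of the merged block
    then gives that of [r]. The two flattenings agree after this, and [set_blocks_inj] applies. *)
Lemma merged_blocks_inj l r mid l' r' mid' :
    uniq (flatten (l :: rcons mid r)) ->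
    [::] \notin l :: rcons mid r -> [::] \notin l' :: rcons mid' r' ->
    mid != [::] -> mid' != [::] ->
    flatten (l :: rcons mid r) = flatten (l' :: rcons mid' r') ->
    set_blocks ((r ++ l) :: mid) = set_blocks ((r' ++ l') :: mid') ->
  size r = size r' /\ (r ++ l) :: mid = (r' ++ l') :: mid'.
Proof.
move=> u n0 n0' m0 m0' e eb.
have u' : uniq (flatten (l' :: rcons mid' r')) by rewrite -e.
have szl : size l = size l'.
  apply/eqP; rewrite eqn_leq (merged_blocks_leq u n0 n0' m0' e eb).
  by rewrite (merged_blocks_leq u' n0' n0 m0 (esym e) (esym eb)).
have szr : size r = size r'.
  have := uniq_merge u; have := uniq_merge u'; rewrite /= !(cat_uniq (_ ++ _)).
  move=> /and3P[w' _ _] /and3P[w _ _].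
  have := uniq_size_uniq w (merged_blocks_head u n0 n0' e eb).
  by rewrite w' !size_cat szl eqn_add2r => /esym/eqP.
split=> //; apply: set_blocks_inj eb; rewrite ?uniq_merge ?nil_merge //.
move: e => /= /eqP; rewrite eqseq_cat // !flatten_rcons => /andP[/eqP-> /eqP e].
have /eqP := e; rewrite eqseq_cat => [/andP[/eqP-> /eqP->] //|].
by move/(congr1 size): e; rewrite !size_cat szr => /addIn.
Qed.

End MergedBlocks.

(** * Enumeration of the splits of a block by arc sizes *)

Section Arcs.
Variable n : nat.
Implicit Types (B : {set 'I_n}) (P : {set {set 'I_n}}).

(* The arcs of B, in cyclic order from the one of min B on, of sizes u. They form
   an interval partition if k = 0; for 0 < k < head 0 u the first arc consists
   of the last k and the first head 0 u - k elements of B. *)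
Definition arc_lists B (u : seq nat) (k : nat) : seq (seq 'I_n) :=
  reshape u (rotr k (enum B)).

Lemma arc_listsP B u k m : u \in compositions #|B| m ->
  [/\ flatten (arc_lists B u k) = rotr k (enum B), shape (arc_lists B u k) = u,
      [::] \notin arc_lists B u k & size (arc_lists B u k) = m].
Proof.
rewrite mem_compositions => /and3P[/eqP um /eqP uB u1].
have szB : size (rotr k (enum B)) = sumn u by rewrite size_rotr -cardE uB.
have shE : shape (arc_lists B u k) = u by rewrite reshapeKl ?szB.
split=> //.
- by rewrite reshapeKr ?szB.
- apply: contraTN u1 => /(map_f size); rewrite -/(shape _) shE => /= u0.
  by apply/negP => /allP/(_ 0%N u0).
- by rewrite -um -[in RHS]shE size_map.
Qed.

Lemma composition_shape (T : eqType) (ss : seq (seq T)) : [::] \notin ss ->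
  shape ss \in compositions (size (flatten ss)) (size ss).
Proof.
move=> ss0; rewrite mem_compositions size_map eqxx -size_flatten eqxx.
apply/allP => _ /mapP[l lss ->]; rewrite lt0n size_eq0.
by apply: contraNneq ss0 => <-.
Qed.

Lemma arc_lists0 B ss : flatten ss = enum B -> arc_lists B (shape ss) 0 = ss.
Proof. by move=> eB; rewrite /arc_lists /rotr subn0 rot_size -eB flattenK. Qed.

Lemma arc_lists_merge B l mid r : flatten (l :: rcons mid r) = enum B ->
  arc_lists B (shape ((r ++ l) :: mid)) (size r) = (r ++ l) :: mid.
Proof.
move=> eB; rewrite -[RHS]flattenK /arc_lists -eB /= flatten_rcons catA.
by rewrite rotr_size_cat catA.
Qed.

(** [rotr k] puts the last [k] elements of [B] in front, and the first arc goes on with the least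
    [head 0 u - k] ones. The bounds on [k] make both pieces nonempty, and [1 < m] leaves a middle
    block. *)
Lemma arc_lists_wrap B u k m : u \in compositions #|B| m -> (1 < m)%N ->
    (0 < k < head 0%N u)%N ->
  exists l mid r, [/\ flatten (l :: rcons mid r) = enum B,
    [::] \notin l :: rcons mid r, mid != [::], size r = k &
    arc_lists B u k = (r ++ l) :: mid].
Proof.
move=> uB m1 /andP[k0 ku]; have [flE shE n0 szE] := arc_listsP k uB.
move: uB; rewrite mem_compositions => /and3P[_ /eqP uB _].
case: (arc_lists B u k) flE shE n0 szE => [|p mid] flE shE n0 szE.
  by rewrite -szE in m1.
have kp : (k < size p)%N by rewrite -shE in ku.
exists (drop k p), mid, (take k p).
have szk : size (take k p) = k by rewrite size_takel // ltnW.
split=> //; last by rewrite cat_take_drop.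
- apply: (@rotr_inj k); rewrite -flE /= flatten_rcons catA -[k in rotr k _]szk.
  by rewrite rotr_size_cat catA cat_take_drop.
- move: n0; rewrite !inE mem_rcons inE !negb_or => /andP[_ ->]; rewrite andbT.
  by rewrite ![[::] == _]eq_sym -!size_eq0 szk size_drop subn_eq0 -ltnNge kp -lt0n.
- by case: mid szE {flE shE n0} => // szE; rewrite -szE in m1.
Qed.

Lemma big_image_uniq (V : nmodType) (I : finType) (J : eqType) (s : seq J)
    (f : J -> I) (p : pred I) (F : I -> V) :
    {in s &, injective f} -> uniq s -> (forall x, p x = (x \in map f s)) ->
  \sum_(x | p x) F x = \sum_(y <- s) F (f y).
Proof.
move=> fI us ps; rewrite -(big_map f xpredT F) big_uniq ?map_inj_in_uniq //.
exact: eq_bigl.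
Qed.

(** An interval partition is determined by its block sizes from left to right. *)
Lemma sum_interval_partition (V : nmodType) B m (F : {set {set 'I_n}} -> V) :
  \sum_(P | interval_partition B P && (#|P| == m)) F P =
  \sum_(u <- compositions #|B| m) F (set_blocks (arc_lists B u 0)).
Proof.
apply: big_image_uniq; last move=> P; rewrite ?compositions_uniq //.
  move=> u v /(arc_listsP 0)[fu su nu _] /(arc_listsP 0)[fv sv nv _] e.
  rewrite -su -sv; congr (shape _); apply: set_blocks_inj e => //.
    by rewrite fu rotr_uniq enum_uniq.
  by rewrite fu.
apply/andP/mapP => [[/interval_partition_ex[ss [eB ss0 ->]]]|[u uB ->]].
  rewrite card_set_blocks ?eB ?enum_uniq // => /eqP <-.
  exists (shape ss); last by rewrite arc_lists0.
  by rewrite cardE -eB composition_shape.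
have [fu su nu <-] := arc_listsP 0 uB.
rewrite card_set_blocks ?fu ?rotr_uniq ?enum_uniq //; split=> //.
by apply: interval_partition_blocks; rewrite ?fu // /rotr subn0 rot_size.
Qed.

(** A near interval partition corresponds to its arc sizes [u] and the number [k] of elements of the
    wrapped arc at the right end; [merged_blocks_inj] makes this pair unique. Merging turns [m + 1]
    blocks into [m], so [1 < m] matches the minimum of three blocks. *)
Lemma sum_near_interval_partition (V : nmodType) B m
    (F : {set {set 'I_n}} -> V) : (1 < m)%N ->
  \sum_(P | near_interval_partition B P && (#|P| == m)) F P =
  \sum_(u <- compositions #|B| m) \sum_(k <- iota 1 (head 0%N u).-1)
     F (set_blocks (arc_lists B u k)).
Proof.
move=> m1.
pose s := [seq (u, k) | u <- compositions #|B| m, k <- iota 1 (head 0%N u).-1].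
have memI u k : (k \in iota 1 (head 0%N u).-1) = (0 < k < head 0%N u)%N.
  by rewrite mem_iota; case: (head _ _) => [|x]; lia.
transitivity (\sum_(y <- s) F (set_blocks (arc_lists B y.1 y.2))); last first.
  by rewrite /s big_allpairs_dep.
apply: big_image_uniq.
- move=> _ _ /allpairsPdep[u [k [uB ku ->]]] /allpairsPdep[v [j [vB jv ->]]] /= e.
  rewrite memI in ku; rewrite memI in jv.
  have [l [mid [r [f1 n1 mid1 sr eu]]]] := arc_lists_wrap uB m1 ku.
  have [l' [mid' [r' [f2 n2 mid2 sr' ev]]]] := arc_lists_wrap vB m1 jv.
  have [] := @merged_blocks_inj _ l r mid l' r' mid'; rewrite -?eu -?ev ?f1 ?enum_uniq //.
  rewrite sr sr' => <- /(congr1 shape).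
  by have [_ -> _ _] := arc_listsP k uB; have [_ -> _ _] := arc_listsP k vB => ->.
- apply: allpairs_uniq_dep => [|u _|]; rewrite ?compositions_uniq ?iota_uniq //.
  by move=> [u k] [v j] _ _ /= [-> ->].
move=> P; apply/andP/mapP => [[/near_interval_partition_ex]|].
  move=> [l [mid [r [f1 n1 mid1 ->]]]].
  have u1 : uniq (flatten (l :: rcons mid r)) by rewrite f1 enum_uniq.
  rewrite card_set_blocks ?uniq_merge ?nil_merge // => /eqP szm.
  exists (shape ((r ++ l) :: mid), size r); last by rewrite arc_lists_merge.
  apply/allpairsPdep; exists (shape ((r ++ l) :: mid)), (size r); split=> //.
    have := composition_shape (nil_merge n1); rewrite szm; congr (_ \in compositions _ _).
    by rewrite cardE -f1 /= flatten_rcons !size_cat; lia.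
  rewrite memI /= size_cat -{2}[size r]addn0 ltn_add2l !lt0n !size_eq0.
  move: n1; rewrite inE mem_rcons inE !negb_or => /and3P[].
  by rewrite ![[::] == _]eq_sym => -> ->.
move=> [_ /allpairsPdep[u [k [uB ku ->]]] ->] /=; rewrite memI in ku.
have [l [mid [r [f1 n1 mid1 sr eu]]]] := arc_lists_wrap uB m1 ku.
have [fu _ nu <-] := arc_listsP k uB.
rewrite card_set_blocks ?fu ?rotr_uniq ?enum_uniq //; split=> //.
by rewrite eu near_interval_partition_blocks.
Qed.

End Arcs.

(** * Splitting one block *)

Section Splits.
Variable n : nat.
Implicit Types (A B C : {set 'I_n}) (P Q pi rho : {set {set 'I_n}}).

Lemma interval_partition_partition B P : interval_partition B P -> partition P B.
Proof. by case/andP. Qed.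

Lemma near_interval_partition_partition B P :
  near_interval_partition B P -> partition P B.
Proof.
case/near_interval_partition_ex => l [mid [r [eB n0 _ ->]]].
have u : uniq (flatten (l :: rcons mid r)) by rewrite eB enum_uniq.
have := partition_set_blocks (uniq_merge u) (nil_merge n0); congr partition.
apply/setP => x; rewrite -[in RHS](set_enum B) -eB !inE /= flatten_rcons !mem_cat.
by case: (x \in l); case: (x \in r); case: (x \in flatten mid).
Qed.

(** An element of a middle block lies between one of [l] and one of [r], so the merged block is not
    an interval of [B]. *)
Lemma interval_near_disjoint B P :
  interval_partition B P -> ~~ near_interval_partition B P.
Proof.
move=> /andP[_ /'forall_implyP intP]; apply/negP => /near_interval_partition_ex.
case=> l [mid [r [eB n0 mid0 eP]]]; move: intP; rewrite eP => {eP P} intP.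
have := intP [set:: r ++ l]; rewrite set_blocks_cons setU11 => /(_ isT).
case/'exists_andP => a [aB /'exists_andP[b [bB /eqP/setP AE]]].
have := pairwise_enum B; have := enum_uniq B; have := mem_enum B; rewrite -{}eB.
case: mid mid0 n0 {intP} => // m mid _; rewrite !inE !negb_or => /andP[l0 /andP[m0]].
rewrite mem_rcons inE negb_or => /andP[r0 _].
case: l r m l0 r0 m0 AE => [|x l] [|y r] [|z m] // _ _ _ AE BE.
set s := flatten _; have -> : s = (x :: l) ++ (z :: m ++ flatten mid) ++ (y :: r).
  by rewrite /s /= flatten_rcons catA.
rewrite !pairwise_cat => u /and3P[/allrelP xzy _ /andP[/allrelP zy _]].
have zB : z \in B by rewrite -BE /= inE mem_cat mem_head !orbT.
have /and3P[_ ax _] : (x \in B) && (a <= x <= b)%N.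
  by have := AE x; rewrite !in_set mem_cat mem_head orbT => <-.
have /and3P[_ _ yb] : (y \in B) && (a <= y <= b)%N.
  by have := AE y; rewrite !in_set mem_cat mem_head => <-.
have := AE z; rewrite !in_set zB.
have xz : (x < z)%N by apply: xzy; rewrite ?mem_head // mem_cat mem_head.
have zy' : (z < y)%N by apply: zy; rewrite mem_head.
rewrite (leq_trans ax (ltnW xz)) (leq_trans (ltnW zy') yb) /=.
move: u; rewrite cat_uniq => /and3P[_ /hasPn zl].
rewrite cat_uniq => /and3P[_ /hasPn yrz _].
have /negPf {}zl : z \notin x :: l by apply: zl; rewrite mem_cat mem_head.
rewrite -cat_cons mem_cat zl orbF => zr.
by have := yrz z zr; rewrite /= mem_head.
Qed.

Lemma noncrossingP pi :
  reflect (forall A B (i j k l : 'I_n), A \in pi -> B \in pi -> A != B ->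
             (i < j)%N -> (j < k)%N -> (k < l)%N ->
             i \in A -> k \in A -> j \in B -> l \in B -> False)
          (noncrossing pi).
Proof.
apply: (iffP 'forall_implyP) => [h A B i j k l Api Bpi AB ij jk kl iA kA jB lB|h A Api].
  have /'forall_implyP/(_ B Bpi)/implyP/(_ AB)/negP := h A Api; apply.
  apply/existsP; exists i; apply/existsP; exists j.
  apply/existsP; exists k; apply/existsP; exists l.
  by rewrite ij jk kl iA kA jB lB.
apply/'forall_implyP => B Bpi; apply/implyP => AB; apply/negP.
case/existsP=> i /existsP[j /existsP[k /existsP[l]]].
by case/and5P => ij jk kl iA /and3P[kA jB lB]; apply: (h A B i j k l).
Qed.

(** Of two crossing blocks at least one differs from [A0], hence is an interval; it surrounds an
    element of the other block, against disjointness. The exception [A0] is meant for the merged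
    block of a near interval partition. *)
Lemma almost_interval_noncrossing B P A0 : partition P B ->
  {in P, forall A, A != A0 -> interval_in B A} -> noncrossing P.
Proof.
move=> pP intP; have /and3P[/eqP cov /trivIsetP tri _] := pP.
have sub A x : A \in P -> x \in A -> x \in B.
  by move=> AP xA; rewrite -cov; apply/bigcupP; exists A.
have conv A x y z : A \in P -> A != A0 -> x \in A -> z \in A -> y \in B ->
    (x < y < z)%N -> y \in A.
  move=> AP AA0 xA zA yB /andP[xy yz].
  have /'exists_andP[a [_ /'exists_andP[b [_ /eqP defA]]]] := intP A AP AA0.
  move: xA zA; rewrite defA !inE => /and3P[_ ax _] /and3P[_ _ zb].
  by rewrite yB (leq_trans ax (ltnW xy)) (leq_trans (ltnW yz) zb).
apply/noncrossingP => A C i j k l AP CP AC ij jk kl iA kA jC lC.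
have dAC := tri A C AP CP AC.
have [A_0|AA0] := eqVneq A A0; last first.
  suff jA : j \in A by rewrite (disjointFr dAC jA) in jC.
  by apply: (conv A i j k); rewrite ?ij // (sub C).
suff kC : k \in C by rewrite (disjointFr dAC kA) in kC.
by apply: (conv C j k l); rewrite ?jk // ?(sub A) // -A_0 eq_sym.
Qed.

Lemma interval_partition_noncrossing B P : interval_partition B P -> noncrossing P.
Proof.
case/andP=> pP /'forall_implyP intP.
by apply: (almost_interval_noncrossing (A0 := set0) pP) => A AP _; apply: intP.
Qed.

Lemma near_interval_partition_noncrossing B P :
  near_interval_partition B P -> noncrossing P.
Proof.
move=> nP; have pP := near_interval_partition_partition nP.
have [Q /existsP[L /existsP[R /and5P[iQ _ _ _ /eqP eP]]]] := existsP nP.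
apply: (almost_interval_noncrossing (A0 := L :|: R) pP) => A.
rewrite eP in_setU1 => /predU1P[->|]; first by rewrite eqxx.
by move=> /setD1P[_ /setD1P[_ AQ]] _; move: iQ => /andP[_ /'forall_implyP]; apply.
Qed.

Lemma partition_split pi B P D : partition pi D -> B \in pi -> partition P B ->
  partition ((pi :\ B) :|: P) D.
Proof.
move=> ppi Bpi pP; have /and3P[covD triD D0] := partitionD1 ppi Bpi.
have /and3P[covP triP P0] := pP; have BD : B \subset D.
  by rewrite -(cover_partition ppi); apply: bigcup_sup.
apply/and3P; split.
- rewrite /cover bigcup_setU -!/(cover _) (eqP covD) (eqP covP) setUC.
  by rewrite -{1}(setIidPr BD) setID.
- apply: trivIsetU => //; rewrite (eqP covD) (eqP covP).
  by rewrite disjoints_subset setDE subsetIr.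
- by rewrite in_setU negb_or D0.
Qed.

(** Blocks of [P] lie inside [B], so a crossing of one of them with an old block is already a
    crossing of [B] with that block. *)
Lemma noncrossing_split pi B P : noncrossing pi -> B \in pi -> partition P B ->
  noncrossing P -> noncrossing ((pi :\ B) :|: P).
Proof.
move=> /noncrossingP ncpi Bpi pP /noncrossingP ncP.
have sub A x : A \in P -> x \in A -> x \in B.
  by move=> AP xA; rewrite -(cover_partition pP); apply/bigcupP; exists A.
apply/noncrossingP => A C i j k l; rewrite !in_setU !in_setD1.
move=> /orP[/andP[AB Api]|AP] /orP[/andP[CB Cpi]|CP] AC ij jk kl iA kA jC lC.
- exact: (ncpi A C i j k l).
- by apply: (ncpi A B i j k l) => //; apply: sub CP _.
- by apply: (ncpi B C i j k l); rewrite 1?eq_sym //; apply: sub AP _.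
- exact: (ncP A C i j k l).
Qed.

Section OneSplit.
Variables (pi P : {set {set 'I_n}}) (B D : {set 'I_n}).
Hypotheses (partpi : partition pi D) (Bpi : B \in pi).
Hypotheses (partP : partition P B) (P1 : (1 < #|P|)%N).

Lemma split_block_notin : B \notin P.
Proof.
apply/negP => BP; have := P1; rewrite (cardsD1 B) BP ltnS => /card_gt0P[C].
case/setD1P => CB CP; have /and3P[/eqP cov /trivIsetP tri _] := partP.
have [x xC] := set0Pn _ (partition_neq0 partP CP).
have xB : x \in B by rewrite -cov; apply/bigcupP; exists C.
by have := tri C B CP BP CB => /disjointFr/(_ xC); rewrite xB.
Qed.

Lemma split_blocks_disjoint C : C \in P -> C \notin pi.
Proof.
move=> CP; apply/negP => Cpi; have /and3P[_ /trivIsetP tri _] := partpi.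
have [x xC] := set0Pn _ (partition_neq0 partP CP).
have xB : x \in B by rewrite -(cover_partition partP); apply/bigcupP; exists C.
have [CB|CB] := eqVneq C B; first by case/negP: split_block_notin; rewrite -CB.
by have := tri C B Cpi Bpi CB => /disjointFr/(_ xC); rewrite xB.
Qed.

(** Together with [split_blocksE], this recovers [B] and [P] from the partitions before and after
    the split, which gives the injectivity behind [sum_splits]. *)
Lemma split_blockE : pi :\: ((pi :\ B) :|: P) = [set B].
Proof.
apply/setP => C; rewrite !inE; have [->|CB] /= := eqVneq C B.
  by rewrite Bpi (negPf split_block_notin).
by case: (C \in pi); rewrite ?andbF ?orbT.
Qed.

Lemma split_blocksE : ((pi :\ B) :|: P) :\: pi = P.
Proof.
apply/setP => C; rewrite !inE; have := @split_blocks_disjoint C.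
by case: (C \in P); [move=> ->|rewrite orbF andbC => _; case: (C \in pi)]; rewrite ?orbT ?andbF.
Qed.

Lemma perm_card_split :
  perm_eq [seq #|(A : {set 'I_n})| | A <- enum ((pi :\ B) :|: P)]
          ([seq #|(A : {set 'I_n})| | A <- enum P]
             ++ rem #|B| [seq #|(A : {set 'I_n})| | A <- enum pi]).
Proof.
have Be : B \in enum pi by rewrite mem_enum.
apply: (@perm_trans _ ([seq #|(A : {set 'I_n})| | A <- enum P ++ rem B (enum pi)])).
  apply: perm_map; apply: uniq_perm; rewrite ?enum_uniq //.
    rewrite cat_uniq enum_uniq rem_uniq ?enum_uniq // andbT /=.
    apply/hasPn => C; rewrite mem_rem_uniq ?enum_uniq // !inE !mem_enum => /andP[_].
    by apply: contraL => /split_blocks_disjoint.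
  by move=> C; rewrite mem_enum mem_cat mem_rem_uniq ?enum_uniq // !inE !mem_enum orbC.
rewrite map_cat perm_cat2l -(perm_cons #|B|).
have Bs : #|B| \in [seq #|(A : {set 'I_n})| | A <- enum pi] by apply: map_f.
rewrite -(permPr (perm_to_rem Bs)) perm_sym.
have := perm_map (fun A : {set 'I_n} => #|A|) (perm_to_rem Be).
by move/permPl ->.
Qed.

End OneSplit.

Variable kind : {set 'I_n} -> {set {set 'I_n}} -> bool.
Hypothesis kind_partition : forall B P, kind B P -> partition P B.

Lemma sum_splits (V : nmodType) m pi D (F : {set {set 'I_n}} -> V) :
    (1 < m)%N -> partition pi D ->
  \sum_(rho | splits kind m rho pi) F rho =
  \sum_(B in pi) \sum_(P | kind B P && (#|P| == m)) F ((pi :\ B) :|: P).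
Proof.
move=> m1 ppi; rewrite pair_big_dep /=.
pose S := [set x : {set 'I_n} * {set {set 'I_n}} |
             (x.1 \in pi) && (kind x.1 x.2 && (#|x.2| == m))].
pose f (x : {set 'I_n} * {set {set 'I_n}}) := (pi :\ x.1) :|: x.2.
transitivity (\sum_(rho in f @: S) F rho).
  apply: eq_bigl => rho; apply/'exists_andP/imsetP.
    case=> B [Bpi /existsP[P /and3P[kP cP /eqP ->]]].
    by exists (B, P); rewrite // inE Bpi kP cP.
  case=> -[B P]; rewrite inE => /and3P[Bpi kP cP] ->.
  by exists B; split=> //; apply/existsP; exists P; rewrite kP cP /=.
rewrite big_imset /=; first by apply: eq_bigl => x; rewrite inE.
move=> [B P] [C Q]; rewrite !inE /= => /and3P[Bpi kP /eqP cP] /and3P[Cpi kQ /eqP cQ].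
rewrite /f /= => e.
have cP1 : (1 < #|P|)%N by rewrite cP.
have cQ1 : (1 < #|Q|)%N by rewrite cQ.
have := split_blocksE ppi Bpi (kind_partition kP) cP1.
rewrite e (split_blocksE ppi Cpi (kind_partition kQ) cQ1) => ->.
have := split_blockE Bpi (kind_partition kP) cP1.
by rewrite e (split_blockE Cpi (kind_partition kQ) cQ1) => /set1_inj ->.
Qed.

End Splits.

(** * Weighted sum over one split *)

Section ChainSum.
Variables (n : nat) (R : comPzRingType) (Y : nat -> R) (a : nat -> nat).
Implicit Types (B : {set 'I_n}) (P pi rho : {set {set 'I_n}}).

Definition block_sizes pi : seq nat := [seq #|(B : {set 'I_n})| | B <- enum pi].

(** The value 0 off the splits lets sums run over all partitions [rho]. *)
Definition step_weight (t : nat) rho pi : R :=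
  if splits (@interval_partition n) (a t) rho pi then 1
  else if splits (@near_interval_partition n) (a t) rho pi then Y t else 0.

Lemma splits_interval_near m rho pi D : (1 < m)%N -> partition pi D ->
  splits (@interval_partition n) m rho pi ->
  ~~ splits (@near_interval_partition n) m rho pi.
Proof.
move=> m1 ppi /'exists_andP[B [Bpi /existsP[P /and3P[iP /eqP cP /eqP ->]]]].
apply/negP; case/'exists_andP=> C [Cpi /existsP[Q /and3P[nQ /eqP cQ /eqP e]]].
have pP := interval_partition_partition iP.
have pQ := near_interval_partition_partition nQ.
have cP1 : (1 < #|P|)%N by rewrite cP.
have cQ1 : (1 < #|Q|)%N by rewrite cQ.
have ePQ : P = Q.
  by rewrite -(split_blocksE ppi Bpi pP cP1) e (split_blocksE ppi Cpi pQ cQ1).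
have eBC : B = C.
  by apply: set1_inj; rewrite -(split_blockE Bpi pP cP1) e (split_blockE Cpi pQ cQ1).
by case/negP: (interval_near_disjoint iP); rewrite ePQ eBC.
Qed.

(** For given arc sizes [u], the position k = 0 has weight 1 and each 0 < k < [head 0 u] has weight
    [Y t]. All positions produce the same block sizes, so the value of [chain_gf] factors out. *)
Lemma sum_step_weight t pi D : (1 < a t)%N -> partition pi D ->
  \sum_rho step_weight t rho pi * chain_gf Y a t (block_sizes rho) =
  chain_gf Y a t.+1 (block_sizes pi).
Proof.
move=> at1 ppi; pose h rho := chain_gf Y a t (block_sizes rho).
transitivity (\sum_(rho | splits (@interval_partition n) (a t) rho pi) h rho +
    Y t * \sum_(rho | splits (@near_interval_partition n) (a t) rho pi) h rho).
  rewrite mulr_sumr [X in _ = X + _]big_mkcond [X in _ = _ + X]big_mkcond.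
  rewrite -big_split; apply: eq_bigr => rho _; rewrite /step_weight /=.
  case i: (splits _ _ _ _); case j: (splits _ _ _ _).
  - by rewrite (negPf (splits_interval_near at1 ppi i)) in j.
  - by rewrite mul1r addr0.
  - by rewrite add0r.
  - by rewrite mul0r addr0.
rewrite (sum_splits (@interval_partition_partition n) _ at1 ppi).
rewrite (sum_splits (@near_interval_partition_partition n) _ at1 ppi).
rewrite mulr_sumr -big_split /= /block_sizes big_map big_enum /=.
apply: eq_bigr => B Bpi.
rewrite sum_interval_partition sum_near_interval_partition // mulr_sumr -big_split.
rewrite big_seq [RHS]big_seq; apply: eq_bigr => u uB /=.
have hE k : chain_gf Y a t
    (block_sizes ((pi :\ B) :|: set_blocks (arc_lists B u k))) =
    chain_gf Y a t (u ++ rem #|B| (block_sizes pi)).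
  have [fu su nu zu] := arc_listsP k uB.
  have uu : uniq (flatten (arc_lists B u k)) by rewrite fu rotr_uniq enum_uniq.
  apply: perm_chain_gf; apply: perm_trans (perm_card_split ppi Bpi _ _) _.
  - have := partition_set_blocks uu nu; congr partition.
    by apply/setP=> x; rewrite inE fu mem_rotr mem_enum.
  - by rewrite card_set_blocks // zu.
  by rewrite perm_cat2r (permPl (perm_card_set_blocks uu nu)) su.
rewrite /h hE (eq_bigr (fun=> chain_gf Y a t (u ++ rem #|B| (block_sizes pi)))).
  by rewrite big_const_seq count_predT size_iota iter_addr_0 mulrDl mul1r mulrnAr mulrnAl.
by move=> k _; apply: hE.
Qed.

Lemma splits_noncrossing m rho pi :
    partition pi [set: 'I_n] && noncrossing pi ->
    splits (@interval_partition n) m rho pi ||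
    splits (@near_interval_partition n) m rho pi ->
  partition rho [set: 'I_n] && noncrossing rho.
Proof.
move=> /andP[ppi ncpi] /orP[] /'exists_andP[B [Bpi /existsP[P /and3P[kP _ /eqP->]]]].
  have pP := interval_partition_partition kP.
  rewrite (partition_split ppi) //= noncrossing_split //.
  exact: interval_partition_noncrossing kP.
have pP := near_interval_partition_partition kP.
rewrite (partition_split ppi) //= noncrossing_split //.
exact: near_interval_partition_noncrossing kP.
Qed.

(** Splits of a noncrossing partition are noncrossing, so the terms outside [ncpartition n]
    vanish. *)
Lemma sum_step_weight_nc t (pi : ncpartition n) : (1 < a t)%N ->
  \sum_(rho : ncpartition n)
     step_weight t rho pi * chain_gf Y a t (block_sizes rho) =
  chain_gf Y a t.+1 (block_sizes pi).
Proof.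
move=> at1; have /andP[ppi _] := valP pi; rewrite -(sum_step_weight at1 ppi).
rewrite [RHS](bigID (fun rho => partition rho [set: 'I_n] && noncrossing rho)) /=.
rewrite [X in _ = _ + X]big1 ?addr0 => [|rho nrho].
  rewrite [RHS](reindex_omap (val : ncpartition n -> _) insub) => [|rho nrho]; last by rewrite insubT.
  by apply: eq_bigl => rho; rewrite valK eqxx (valP rho).
rewrite /step_weight; case: ifP => i; last case: ifP => j; last by rewrite mul0r.
  by rewrite (@splits_noncrossing (a t) rho pi) ?(valP pi) ?i in nrho.
by rewrite (@splits_noncrossing (a t) rho pi) ?(valP pi) ?j ?orbT in nrho.
Qed.

Lemma chain_gf0 (pi : ncpartition n) :
  chain_gf Y a 0 (block_sizes pi) = (ncval pi == partition_bot n)%:R.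
Proof.
have /andP[ppi _] := valP pi; congr (_%:R); congr nat_of_bool; rewrite all_map.
apply/allP/eqP => [pi1|-> B]; last first.
  by rewrite mem_enum => /imsetP[x _ ->] /=; rewrite cards1.
have single B x : B \in ncval pi -> x \in B -> B = [set x].
  move=> Bpi xB; have /cards1P[y defB] : #|B| == 1%N by apply: pi1; rewrite mem_enum.
  by move: xB; rewrite defB => /set1P ->.
apply/setP => B; apply/idP/imsetP => [Bpi|[x _ ->]].
  have [x xB] := set0Pn _ (partition_neq0 ppi Bpi).
  by exists x; rewrite // (single B x).
have xcov : x \in cover (ncval pi) by rewrite (cover_partition ppi) inE.
by rewrite -(single (pblock pi x) x) ?pblock_mem ?mem_pblock.
Qed.

End ChainSum.

(** Transfer-matrix expansion: iterating the recursion yields all paths ending at [y], each with the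
    product of its step weights. *)
Lemma sum_paths (R : comPzRingType) (T : finType) (w : nat -> T -> T -> R)
    (F : nat -> T -> R) (r : nat) (y : T) :
    (forall t z, (t < r)%N -> F t.+1 z = \sum_x w t x z * F t x) ->
  F r y = \sum_(p : r.+1.-tuple T | tnth p (inord r) == y)
             F 0%N (tnth p (inord 0)) *
             \prod_(i < r) w i (tnth p (inord i)) (tnth p (inord i.+1)).
Proof.
elim: r y => [|r IH] y FS.
  rewrite (big_pred1 [tuple y]) => [|p].
    by rewrite big_ord0 mulr1 (tnth_nth y) inordK.
  apply/eqP/eqP => [<-|->]; last by rewrite (tnth_nth y) inordK.
  by apply: eq_from_tnth => i; rewrite !(tnth_nth y) inordK // ord1.
have FS' t z : (t < r)%N -> F t.+1 z = \sum_x w t x z * F t x.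
  by move=> tr; apply: FS; apply: ltnW.
(* A path of [r.+1] steps ending at [y] is a path of [r] steps with [y] appended; the inverse map
   drops the last vertex. *)
rewrite FS // (reindex_onto (fun q : r.+1.-tuple T => [tuple of rcons q y])
  (fun p => [tuple tnth p (widen_ord (leqnSn _) i) | i < r.+1])) /=; last first.
  move=> p /eqP py; apply: eq_from_tnth => i; rewrite (tnth_nth y) nth_rcons size_map size_enum_ord.
  case: (ltngtP i r.+1) => [ir|ir|ir].
  - rewrite (nth_map (Ordinal ir)) ?size_enum_ord //.
    by congr tnth; apply: val_inj; rewrite /= nth_enum_ord.
  - by have := ltn_ord i; rewrite ltnS leqNgt ir.
  - by rewrite -py; congr tnth; apply: val_inj; rewrite /= inordK.
have rc (q : r.+1.-tuple T) i : (i <= r)%N ->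
    tnth [tuple of rcons q y] (inord i) = tnth q (inord i).
  by move=> ir; rewrite !(tnth_nth y) /= !inordK ?ltnS ?(leqW ir) // nth_rcons size_tuple ltnS ir.
have rcy (q : r.+1.-tuple T) : tnth [tuple of rcons q y] (inord r.+1) = y.
  by rewrite (tnth_nth y) /= inordK // nth_rcons size_tuple ltnn eqxx.
rewrite (eq_bigr _ (fun x _ => congr1 (fun v => w r x y * v) (IH x FS'))).
under eq_bigr => x _ do rewrite mulr_sumr.
rewrite [RHS](eq_bigl xpredT) => [|q]; last first.
  rewrite rcy eqxx; apply/eqP/eq_from_tnth => i.
  rewrite tnth_mktuple !(tnth_nth y) /= nth_rcons size_tuple ltn_ord //.
rewrite [RHS](partition_big (fun q : r.+1.-tuple T => tnth q (inord r)) xpredT) //=.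
apply: eq_bigr => x _; apply: eq_bigr => q /eqP <-.
rewrite big_ord_recr /= rcy (rc q 0%N) // (rc q r) //.
rewrite [in RHS](eq_bigr (fun i : 'I_r => w i (tnth q (inord i)) (tnth q (inord i.+1)))).
  by ring.
by move=> i _; rewrite !rc // ltnW.
Qed.

(** * Quotients of noncrossing partitions are cycles *)

Section NextFlatten.
Variable T : eqType.
Implicit Types (p q : seq T) (tt : seq (seq T)).

(** The form [head x (q ++ p)] also covers an empty [q], where the last element of [p] returns to
    its first one. *)
Lemma next_cat p q x : uniq (p ++ q) -> x \in p ->
  next (p ++ q) x = if x == last x p then head x (q ++ p) else next p x.
Proof.
case: p => // y p; rewrite cat_uniq => /andP[up _] xp.
have := index_mem x (y :: p); rewrite xp.
have xl : (x == last x (y :: p)) = (index x (y :: p) == size p).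
  apply/eqP/eqP => [e|ei]; first by rewrite (e : x = last y p) index_last.
  by rewrite /= (last_nth y) -ei nth_index.
rewrite xl !next_nth index_cat mem_cat xp; move: (index _ _) => i /=.
rewrite ltnS leq_eqVlt nth_cat; case: ltngtP => //= -> _.
by rewrite subnn; case: q.
Qed.

Lemma next_last p x : uniq p -> x \in p -> x = last x p -> next p x = head x p.
Proof.
move=> up xp xl; have := @next_cat p [::] x; rewrite cats0 => -> //.
by rewrite -xl eqxx.
Qed.

(** [next] is invariant under rotation and rotating [tt] rotates its flattening, so [p] may be
    assumed to come first, where [next_cat] applies. *)
Lemma next_flatten tt p x : uniq (flatten tt) -> uniq tt -> [::] \notin tt ->
    p \in tt -> x \in p ->
  next (flatten tt) x = if x == last x p then head x (next tt p) else next p x.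
Proof.
move=> u ut n0 ptt xp; have [i tt' rotE] := rot_to ptt.
have [j flE] : exists j, flatten (rot i tt) = rot j (flatten tt).
  exists (size (flatten (take i tt))).
  have <- : flatten (take i tt) ++ flatten (drop i tt) = flatten tt.
    by rewrite -flatten_cat cat_take_drop.
  by rewrite rot_size_cat -flatten_cat.
have ntE : next (p :: tt') p = head p tt'.
  by rewrite next_nth mem_head /= eqxx; case: (tt').
rewrite -(next_rot j u) -(next_rot i ut) -flE rotE ntE.
have /= u' : uniq (flatten (p :: tt')) by rewrite -rotE flE rot_uniq.
rewrite /= next_cat //; case: eqP => // _.
case: tt' rotE {u' ntE} => [|[|y q] tt'] rotE //; case/negP: n0.
by rewrite -(mem_rot i) rotE !inE eqxx orbT.
Qed.

End NextFlatten.

Lemma mem_porbit_fcycle (T : finType) (s : {perm T}) (c : seq T) x :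
  fcycle s c -> x \in c -> porbit s x =i c.
Proof.
move=> sc xc y; rewrite -(fconnect_cycle sc xc).
apply/porbitP/idP => [[i ->]|xy]; first by rewrite permX fconnect_iter.
by exists (findex s x y); rewrite permX iter_findex.
Qed.

Section SplitCycle.
Variable n : nat.
Implicit Types (B : {set 'I_n}) (pi rho : ncpartition n).

Lemma next_enum_set p : pairwise (@ord_lt n) p -> next (enum [set:: p]) =1 next p.
Proof. by move=> pw x; rewrite enum_pairwise. Qed.

Lemma pairwise_flatten (ss : seq (seq 'I_n)) p : p \in ss ->
  pairwise (@ord_lt n) (flatten ss) -> pairwise (@ord_lt n) p.
Proof.
by case/splitPr=> s1 s2; rewrite flatten_cat /= !pairwise_cat => /and5P[].
Qed.

(** Common form of both kinds of split: the new blocks are arcs of a rotation of [enum B]. The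
    successor inside a wrapped arc [r ++ l] is that of its sorted enumeration, since [r ++ l] is a
    rotation of [l ++ r]. *)
Lemma split_arcs m (rho pi : {set {set 'I_n}}) :
    splits (@interval_partition n) m rho pi ||
    splits (@near_interval_partition n) m rho pi ->
  exists B tt k, [/\ B \in pi, rho = (pi :\ B) :|: set_blocks tt,
    flatten tt = rotr k (enum B), [::] \notin tt &
    size tt = m /\ {in tt, forall p, next (enum [set:: p]) =1 next p}].
Proof.
case/orP=> /'exists_andP[B [Bpi /existsP[P /and3P[kP /eqP <- /eqP ->]]]].
  have [ss [eB n0 ->]] := interval_partition_ex kP.
  have u : uniq (flatten ss) by rewrite eB enum_uniq.
  exists B, ss, 0%N; rewrite card_set_blocks // /rotr subn0 rot_size; split=> //.
  split=> // p pss; apply/next_enum_set/(pairwise_flatten pss).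
  by rewrite eB pairwise_enum.
have [l [mid [r [eB n0 _ ->]]]] := near_interval_partition_ex kP.
have u : uniq (flatten (l :: rcons mid r)) by rewrite eB enum_uniq.
exists B, ((r ++ l) :: mid), (size r).
rewrite card_set_blocks ?uniq_merge ?nil_merge //; split; rewrite ?nil_merge //.
  by rewrite -eB /= flatten_rcons catA rotr_size_cat catA.
split=> // p; have pw := pairwise_enum B; rewrite -eB in pw.
rewrite inE => /predU1P[->|pmid] x; last first.
  apply/next_enum_set/(pairwise_flatten _ pw).
  by rewrite inE mem_rcons inE pmid !orbT.
have pw' : pairwise (@ord_lt n) (l ++ r).
  move: pw; rewrite /= flatten_rcons !pairwise_cat allrel_catr.
  by case/and3P => /andP[_ ->] -> /and3P[].
have -> : [set:: r ++ l] = [set:: l ++ r] by apply/setP => y; rewrite !inE !mem_cat orbC.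
rewrite next_enum_set // -[r ++ l](rot_size_cat l r) next_rot //.
apply: (sorted_uniq (@ord_lt_trans n)) => [i|]; first exact: ltnn.
by rewrite (sorted_pairwise (@ord_lt_trans n)).
Qed.

Lemma nc_permE pi B x : B \in ncval pi -> x \in B -> nc_perm pi x = next (enum B) x.
Proof.
move=> Bpi xB; rewrite permE /nc_succ.
have /andP[/and3P[_ tri _] _] := valP pi.
by rewrite (def_pblock tri Bpi xB).
Qed.

(** The two permutations can differ only at the last elements of the arcs: there the one of [pi]
    moves on to the head of the next arc, and the one of [rho] returns to the head of the same arc.
    So the quotient permutes these [m] elements cyclically and fixes the rest. *)
Lemma is_cycle_split m rho pi : (0 < m)%N ->
    splits (@interval_partition n) m rho pi ||
    splits (@near_interval_partition n) m rho pi ->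
  is_cycle_of_length ((nc_perm rho)^-1%g \oP nc_perm pi) m.
Proof.
move=> m0 /split_arcs[B [tt [k [Bpi rhoE fl n0 [szt nextt]]]]].
have u : uniq (flatten tt) by rewrite fl rotr_uniq enum_uniq.
have ut := uniq_flatten_nil u n0.
have zE x y : nc_perm pi x = nc_perm rho y ->
    ((nc_perm rho)^-1%g \oP nc_perm pi) x = y.
  by move=> e; rewrite permM e permK.
have memB x : (x \in B) = (x \in flatten tt) by rewrite fl mem_rotr mem_enum.
have piE p x : p \in tt -> x \in p -> nc_perm pi x =
    if x == last x p then head x (next tt p) else next p x.
  move=> ptt xp; rewrite (nc_permE Bpi) ?memB; last by apply/flattenP; exists p.
  by rewrite -(next_rotr k (enum_uniq B)) -fl (next_flatten u ut n0 ptt xp).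
have rE p x : p \in tt -> x \in p -> nc_perm rho x = next p x.
  move=> ptt xp; rewrite (@nc_permE _ [set:: p]) ?inE // ?nextt //.
  by rewrite rhoE in_setU; apply/orP; right; apply/set_blocksP; exists p.
have tt0 : tt != [::] by rewrite -size_eq0 szt -lt0n.
case: tt tt0 szt n0 u ut fl rhoE memB piE rE nextt => // -[//|x0 p0] tt _ szt n0.
set tt1 := _ :: tt in szt n0 *.
move=> u ut fl rhoE memB piE rE nextt.
(* [c] lists the last elements of the arcs, the support of the cycle when [1 < m]; as arcs are
   nonempty, [x0] is a mere default. *)
set z := _ \oP _ in zE *; pose lst := last x0; pose c := [seq lst p | p <- tt1].
have lstP p : p \in tt1 -> lst p \in p.
  by case: p => [|x p]; rewrite ?(negPf n0) // /lst /= mem_last.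
have lstE p x : p \in tt1 -> lst p = last x p.
  by case: p => [|y p]; rewrite ?(negPf n0).
have zc : fcycle z c.
  rewrite /c cycle_map; apply: cycle_from_next => // p ptt /=.
  apply/eqP/zE; have qtt : next tt1 p \in tt1 by rewrite mem_next.
  rewrite (piE p) ?lstP // (rE (next tt1 p)) ?lstP //.
  rewrite -lstE // eqxx (@next_last _ (next tt1 p)) ?lstP -?lstE //.
    by case: (next tt1 p) qtt => // nt; case/negP: n0.
  exact: uniq_flatten_sub u qtt.
have x0c : lst (x0 :: p0) \in c by apply/map_f/mem_head.
apply/existsP; exists (lst (x0 :: p0)).
rewrite (eq_card (mem_porbit_fcycle zc x0c)).
have uc : uniq c.
  rewrite map_inj_in_uniq // => p q ptt qtt e.
  by apply: (uniq_flatten_mem u ptt qtt (lstP p ptt)); rewrite e lstP.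
rewrite (card_uniqP uc) size_map szt eqxx /=.
apply/forallP => x; apply/implyP; rewrite (mem_porbit_fcycle zc x0c) => xc.
(* Outside [B], the block of [x] belongs to both partitions; inside [B], [x] is not the last element
   of its arc. *)
apply/eqP/zE; have [xB|xB] := boolP (x \in B); last first.
  have /andP[ppi _] := valP pi.
  have xA : x \in pblock pi x by rewrite mem_pblock (cover_partition ppi) inE.
  have Api : pblock pi x \in ncval pi by rewrite pblock_mem // (cover_partition ppi) inE.
  rewrite (nc_permE Api) // (@nc_permE rho (pblock pi x)) //.
  rewrite rhoE in_setU in_setD1 Api andbT; apply/orP; left.
  by apply: contraNneq xB => <-.
move: (xB); rewrite memB => /flattenP[p ptt xp].
rewrite (piE p) // (rE p) //; case: eqP => // xl; case/negP: xc.
by rewrite xl -lstE //; apply: map_f.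
Qed.

End SplitCycle.

(** * Permutations attached to noncrossing partitions *)

Section PermOfPartition.
Variable n : nat.
Implicit Types pi rho : ncpartition n.

Lemma mem_pblock_nc pi x : x \in pblock pi x.
Proof. by have /andP[ppi _] := valP pi; rewrite mem_pblock (cover_partition ppi) inE. Qed.

Lemma pblock_nc pi x : pblock pi x \in ncval pi.
Proof. by have /andP[ppi _] := valP pi; rewrite pblock_mem // (cover_partition ppi) inE. Qed.

Lemma porbit_nc_perm pi x : porbit (nc_perm pi) x =i pblock pi x.
Proof.
move=> y; rewrite -[RHS]mem_enum; apply: mem_porbit_fcycle.
  apply: cycle_from_next; first exact: enum_uniq.
  move=> z; rewrite mem_enum => zx /=; apply/eqP.
  exact: nc_permE (pblock_nc pi x) zx.
by rewrite mem_enum mem_pblock_nc.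
Qed.

(** The blocks are recovered as the orbits, by [porbit_nc_perm]. *)
Lemma nc_perm_inj : injective (@nc_perm n).
Proof.
have sub pi rho A : nc_perm pi = nc_perm rho -> A \in ncval pi -> A \in ncval rho.
  move=> e Api; have /andP[ppi _] := valP pi.
  have [x xA] := set0Pn _ (partition_neq0 ppi Api).
  have /and3P[_ tri _] := ppi; rewrite -(def_pblock tri Api xA).
  suff -> : pblock pi x = pblock rho x by apply: pblock_nc.
  by apply/setP => y; rewrite -!porbit_nc_perm e.
move=> pi rho e; apply/val_inj/setP => A.
by apply/idP/idP; apply: sub.
Qed.

Lemma nc_perm_bot pi : ncval pi = partition_bot n -> nc_perm pi = 1%g.
Proof.
move=> bot; apply/permP => x; rewrite perm1 (@nc_permE n pi [set x]) ?inE //.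
  by rewrite enum_set1 /= eqxx.
by rewrite bot; apply: imset_f.
Qed.

Lemma nc_perm_top pi : ncval pi = partition_top n -> nc_perm pi = long_cycle n.
Proof.
move=> top; apply/permP => x; rewrite [RHS]permE (@nc_permE n pi setT) ?inE //; last first.
  by rewrite top inE.
have -> : enum [set: 'I_n] = enum 'I_n by apply: eq_enum => y; rewrite !inE.
case: n x {top pi} => [[]//|k] x; rewrite next_nth mem_enum inE.
case e: (enum _) => [|y s]; first by have := mem_enum 'I_k.+1 x; rewrite e inE.
rewrite -e index_enum_ord; move: e; rewrite enum_ordSl => -[<- <-].
apply: val_inj => /=; have := ltn_ord x; rewrite ltnS leq_eqVlt => /predU1P[->|xk].
  by rewrite modnn nth_default // size_map size_enum_ord.
rewrite (nth_map (Ordinal xk)) ?size_enum_ord //= nth_enum_ord //.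
by rewrite modn_small.
Qed.

Lemma prod_permcomp_telescope (s : nat -> 'S_n) r :
  \big[@permcomp _ / 1%g]_(i < r) ((s i)^-1%g \oP s i.+1) = (s 0%N)^-1%g \oP s r.
Proof.
elim: r s => [|r IH] s; first by rewrite big_ord0 /permcomp mulgV.
rewrite big_ord_recl /=; have := IH (fun i => s i.+1); rewrite /bump /= => ->.
by rewrite /permcomp mulgA mulgKV.
Qed.

End PermOfPartition.

(** * From chains to factorizations *)

Section ChainFactorization.
Variables (n r : nat) (a : r.-tuple nat).
Hypothesis a2 : forall i : 'I_r, (1 < nth 0%N a i)%N.

Lemma chain_factorization_in Pi :
  Pi \in nc_chains n a -> chain_factorization Pi \in min_factorizations n a.
Proof.
rewrite !inE => /and3P[/eqP bot /eqP top /forallP st].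
apply/andP; split.
  apply/forallP => i; rewrite tnth_mktuple; apply: is_cycle_split (st i).
  exact: ltnW.
under eq_bigr => i _ do rewrite tnth_mktuple.
rewrite (prod_permcomp_telescope (fun i => nc_perm (chain_nth Pi i))).
by rewrite nc_perm_bot // (nc_perm_top top) invg1 /permcomp mulg1.
Qed.

(** All chains start at the discrete partition, and each quotient determines the next permutation
    from the previous one, hence the next partition by [nc_perm_inj]. *)
Lemma chain_factorization_inj :
  {in nc_chains n a &, injective (@chain_factorization n r)}.
Proof.
move=> Pi Pi'; rewrite !inE => /and3P[/eqP bot _ _] /and3P[/eqP bot' _ _] e.
have eq_nth i : (i <= r)%N -> chain_nth Pi i = chain_nth Pi' i.
  elim: i => [|i IH] ir; first by apply: val_inj; rewrite [LHS]bot [RHS]bot'.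
  have := congr1 (fun z => tnth z (Ordinal ir)) e; rewrite !tnth_mktuple /=.
  by rewrite (IH (ltnW ir)) => /mulIg/nc_perm_inj.
apply: eq_from_tnth => i; rewrite -(inord_val i).
by apply: eq_nth; rewrite -ltnS.
Qed.

(* Surjectivity of chain_factorization is not needed: a factorization outside its
   image has weight 0. *)
Lemma sum_factorization_weight :
  \sum_(z in min_factorizations n a) factorization_weight a z =
  \sum_(Pi in nc_chains n a) chain_weight a Pi.
Proof.
rewrite [RHS](partition_big (@chain_factorization n r)
  (mem (min_factorizations n a))) => [|Pi]; last exact: chain_factorization_in.
apply: eq_bigr => z _; rewrite /factorization_weight.
case: pickP => [Pi /andP[PiN /eqP <-]|none]; last by rewrite big_pred0.
rewrite (big_pred1 Pi) // => Pi' /=; apply/andP/eqP => [[Pi'N /eqP]|-> //].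
exact: chain_factorization_inj.
Qed.

End ChainFactorization.

(** Supplies the cancellation hypothesis of [sum_chain_gf]; it holds coefficientwise in the
    integers. *)
Lemma mulrIn_mpoly k m : (0 < m)%N -> injective (fun p : {mpoly int[k]} => p *+ m).
Proof.
move=> m0 p q e; apply/mpolyP => d.
have := congr1 (fun p => p@_d) e; rewrite /= !mcoeffMn => /eqP.
by rewrite Num.Theory.eqr_pMn2r // => /eqP.
Qed.

(** * Total weight of the chains *)

Section ChainWeightSum.
Variables (n r : nat) (a : r.+1.-tuple nat).
Hypothesis n_gt0 : (0 < n)%N.
Hypothesis a2 : forall i, (i < r.+1)%N -> (1 < nth 0%N a i)%N.

(* No weight is attached to step 0, and 'X_i is indexed from 0. *)
Definition step_variable (t : nat) : {mpoly int[r]} :=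
  if t is i.+1 then oapp (fun j : 'I_r => 'X_j) 0 (insub i) else 1.

Let w t (rho pi : ncpartition n) : {mpoly int[r]} :=
  step_weight step_variable (nth 0%N a) t rho pi.

(** Step 0 has factor 1 for both kinds of split, and step [i.+1] has factor ['X_i] exactly when it
    is not an interval split. *)
Lemma chain_weightE Pi : Pi \in nc_chains n a ->
  chain_weight a Pi = \prod_(i < r.+1) w i (chain_nth Pi i) (chain_nth Pi i.+1).
Proof.
rewrite inE => /and3P[_ _ /forallP st]; rewrite big_ord_recl.
rewrite [X in X * _](_ : _ = 1); last first.
  rewrite /w /step_weight; case: ifP => // i.
  by have := st ord0; rewrite i /= => ->.
rewrite mul1r /chain_weight big_mkcond; apply: eq_bigr => i _.
rewrite /w /step_weight; have := st (lift ord0 i); rewrite /= /bump /= add1n.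
by case: (splits _ _ _ _) => //= ->; rewrite valK.
Qed.

Lemma partition_top_nc :
  partition (partition_top n) [set: 'I_n] && noncrossing (partition_top n).
Proof.
apply/andP; split.
  have T0 : [set: 'I_n] != set0 by rewrite -card_gt0 cardsT card_ord.
  apply/and3P; split; first by rewrite /cover big_set1.
    by apply/trivIsetP => A B /set1P -> /set1P ->; rewrite eqxx.
  by rewrite inE eq_sym.
by apply/noncrossingP => A B i j k l /set1P -> /set1P ->; rewrite eqxx.
Qed.

(** Among the paths ending at the top, those that are not chains contribute 0: either the 0-step
    [chain_gf] vanishes at a start other than the discrete partition, or some step is not a
    split. *)
Lemma sum_chain_weight :
  \sum_(Pi in nc_chains n a) chain_weight a Pi =
  chain_gf step_variable (nth 0%N a) r.+1 [:: n].
Proof.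
pose top : ncpartition n := NCPartition partition_top_nc.
pose F t (pi : ncpartition n) :=
  chain_gf step_variable (nth 0%N a) t (block_sizes pi).
have -> : chain_gf step_variable (nth 0%N a) r.+1 [:: n] = F r.+1 top.
  by rewrite /F /block_sizes /= /partition_top enum_set1 /= cardsT card_ord.
rewrite (@sum_paths _ _ w F) => [|t z tr]; last first.
  by rewrite /F -sum_step_weight_nc // a2.
rewrite big_mkcond [RHS]big_mkcond; apply: eq_bigr => Pi _.
rewrite /F chain_gf0 -/(chain_nth Pi 0) -/(chain_nth Pi r.+1).
case: ifP => [PiN|].
  rewrite chain_weightE //; move: PiN; rewrite inE => /and3P[-> /eqP t _].
  by rewrite -val_eqE /= t eqxx mul1r.
rewrite inE -[_ == top]val_eqE /=; case: eqP => //= _; last by rewrite mul0r if_same.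
case: eqP => //= _ /negbT /forallPn[i].
rewrite negb_or => /andP[/negPf ni /negPf nn].
by rewrite mul1r (bigD1 i) //= /w /step_weight ni nn mul0r.
Qed.

End ChainWeightSum.

Unset Implicit Arguments.

Theorem theorem1 (n r : nat) (a : r.-tuple nat) (hn : (2 <= n)%N)
    (hr : (1 <= r)%N) (ha : forall i : 'I_r, (2 <= tnth a i)%N)
    (hsum : (\sum_(i < r) (tnth a i - 1))%N = (n - 1)%N) :
  \sum_(z in min_factorizations n a) factorization_weight a z =
  \prod_(i < r.-1) ((partial_sum a i.+1)%:R * 'X_i
                    + (n%:R - (partial_sum a i.+1)%:R)) :> {mpoly int[r.-1]}.
Proof.
case: r a hr ha hsum => // r a _ ha hsum.
have a2 i : (i < r.+1)%N -> (1 < nth 0%N a i)%N.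
  by move=> ir; have := ha (Ordinal ir); rewrite (tnth_nth 0%N).
have n_gt0 : (0 < n)%N by apply: ltnW.
have sumE : partial_sum a r.+1 = (n - 1)%N.
  by rewrite -hsum; apply: eq_bigr => i _; rewrite (tnth_nth 0%N).
have le_sum i : (i <= r.+1)%N -> (partial_sum a i <= n)%N.
  move=> ir; have : (partial_sum a i <= partial_sum a r.+1)%N; last by lia.
  rewrite /partial_sum (big_ord_widen _ (fun j => nth 0 a j - 1)%N ir) big_mkcond.
  by apply: leq_sum => j _; case: ifP.
rewrite sum_factorization_weight; last by move=> i; apply: a2.
(* Both sides are multiplied by [n] to match [sum_chain_gf] with one part. *)
rewrite sum_chain_weight //; apply: (mulrIn_mpoly n_gt0) => /=.
have := @sum_chain_gf _ (@step_variable r) (nth 0%N a) r.+1 1 n (@mulrIn_mpoly r).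
have -> : \sum_(s <- compositions n 1)
    chain_gf (@step_variable r) (nth 0%N a) r.+1 s =
    chain_gf (@step_variable r) (nth 0%N a) r.+1 [:: n].
  rewrite (perm_big [:: [:: n]]) ?big_seq1 //.
  apply: uniq_perm; rewrite ?compositions_uniq // => s.
  rewrite mem_compositions inE; case: s => [|x [|y s]] //=.
    by rewrite addn0 andbT eqseq_cons andbT; case: eqP => // ->.
  by rewrite eqseq_cons andbF.
move=> -> //; first last.
- by rewrite -/(partial_sum a r.+1) sumE; lia.
- by move=> i ir; apply: ltnW; apply: a2.
(* The factor [i = 0] is [n], as its partial sum is empty; it accounts for the multiplier [n]. *)
rewrite mulr1n big_ord_recl big_ord0 mulr0n add0r subn0 mulr_natl.
congr (_ *+ _); apply: eq_bigr => i _.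
rewrite /= /bump /= add1n -/(partial_sum a i.+1) valK /= mulr_natl natrB //.
by apply/le_sum/ltnW; rewrite ltnS.
Qed.
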